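(* Let $\Sigma$ be a $C^2$ compact, connected, embedded surface in $(\mathbb{S}^3,g_h)$ without singular points. If $\Sigma$ has constant mean curvature $H$ such that $H/\sqrt{1+H^2}$ is an irrational number, then $\Sigma$ is congruent with a Clifford torus $\mathcal{T}_\rho$ for some $\rho\in(0,1)$.
   Context: Identify $(x_1,y_1,x_2,y_2)\in\mathbb{R}^4$ with the quaternion $x_1+iy_1+jx_2+ky_2$ and with the pair $(z_1,z_2)$, $z_n=x_n+iy_n$; $p\cdot q$ is the quaternion product and $\langle\cdot,\cdot\rangle$ the Euclidean product. $\mathbb{S}^3$ is the unit sphere with the induced Riemannian metric $g$. Put $V(p)=i\cdot p$, $E_1(p)=j\cdot p$, $E_2(p)=k\cdot p$. The horizontal distribution $\mathcal{H}$ is spanned by $E_1,E_2$, and $g_h$ is the restriction of $g$ to $\mathcal{H}$. For a $C^2$ surface $\Sigma$ with unit normal $N$ in $(\mathbb{S}^3,g)$, put $N_h=N-\langle N,V\rangle V$. A singular point is a point $p\in\Sigma$ with $T_p\Sigma=\mathcal{H}_p$ (equivalently $N_h(p)=0$). Off the singular points put $\nu_h=N_h/|N_h|$; the mean curvature $H$ in $(\mathbb{S}^3,g_h)$ is defined by $-2H=\mathrm{div}_\Sigma\nu_h$, the divergence relative to $\Sigma$. Two surfaces are congruent if some isometry of $(\mathbb{S}^3,g)$ preserving $\mathcal{H}$ maps one onto the other. For $\rho\in(0,1)$ the Clifford torus is $\mathcal{T}_\rho=\{(z_1,z_2)\in\mathbb{S}^3:|z_1|^2=\rho^2\}$. *)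

(* Defs.v *)
From HB Require Import structures.
From mathcomp Require Import all_boot all_order all_algebra.
From mathcomp Require Import all_classical all_reals all_analysis.
Set Implicit Arguments.
Unset Strict Implicit.
Unset Printing Implicit Defensive.
Import Order.TTheory GRing.Theory Num.Theory.
Import numFieldNormedType.Exports.
Local Open Scope classical_set_scope.
Local Open Scope ring_scope.

Section Euclidean.
Context {R : realType}.

Definition dot {n : nat} (u v : 'rV[R]_n) : R := \sum_(i < n) u 0 i * v 0 i.

(* The library norm on ['rV[R]_n] is the sup norm; this is the Euclidean one. *)
Definition enorm {n : nat} (u : 'rV[R]_n) : R := Num.sqrt (dot u u).

(* [C^k] on an open set [U]: the partial derivatives of [C^{k+1}] maps are the
   directional derivatives along fixed vectors, which must again be [C^k]. *)
Fixpoint Ck_on (k : nat) {m n : nat} (U : set 'rV[R]_m)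
    (f : 'rV[R]_m -> 'rV[R]_n) : Prop :=
  if k is k'.+1 then
    (forall x, U x -> differentiable f x) /\
    (forall v, Ck_on k' U (fun x => 'd f x v))
  else forall x, U x -> {for x, continuous f}.

Definition smooth_on {m n : nat} (U : set 'rV[R]_m)
    (f : 'rV[R]_m -> 'rV[R]_n) : Prop := forall k, Ck_on k U f.

End Euclidean.

Section Sphere.
Context {R : realType}.
Local Notation R4 := 'rV[R]_4.

(* [quat a b c d] is the quaternion [a + i b + j c + k d]. *)
Definition quat (a b c d : R) : R4 := \row_(l < 4) [:: a; b; c; d]`_l.

Definition qre (p : R4) : R := p 0 (inord 0).
Definition qi (p : R4) : R := p 0 (inord 1).
Definition qj (p : R4) : R := p 0 (inord 2).
Definition qk (p : R4) : R := p 0 (inord 3).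

Definition qmul (p q : R4) : R4 := quat
  (qre p * qre q - qi p * qi q - qj p * qj q - qk p * qk q)
  (qre p * qi q + qi p * qre q + qj p * qk q - qk p * qj q)
  (qre p * qj q - qi p * qk q + qj p * qre q + qk p * qi q)
  (qre p * qk q + qi p * qj q - qj p * qi q + qk p * qre q).

Definition S3 : set R4 := [set p | dot p p = 1].

Definition V (p : R4) : R4 := qmul (quat 0 1 0 0) p.
Definition E1 (p : R4) : R4 := qmul (quat 0 0 1 0) p.
Definition E2 (p : R4) : R4 := qmul (quat 0 0 0 1) p.

Definition horizontal (p : R4) : set R4 :=
  [set v | exists a b : R, v = a *: E1 p + b *: E2 p].

Definition tangent_S3 (p : R4) : set R4 := [set v | dot v p = 0].

(* Orthogonal projection of [R^4] onto [T_p S^3], for [p] in [S^3]; applied to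
   a Euclidean derivative it gives the Levi-Civita derivative of [(S^3, g)]. *)
Definition proj_S3 (p v : R4) : R4 := v - dot v p *: p.

(* [f] restricted to [U] is a regular parametrization of class [C^2] of the
   relatively open piece [S `&` W] of [S], with continuous inverse [h]. *)
Definition chart (S : set R4) (U : set 'rV[R]_2) (f : 'rV[R]_2 -> R4) : Prop :=
  [/\ open U, Ck_on 2 U f,
      forall u, U u -> injective ('d f u) &
      exists (W : set R4) (h : R4 -> 'rV[R]_2),
        [/\ open W, f @` U = S `&` W, {in U, cancel f h} &
            {within S `&` W, continuous h}]].

Definition embedded_surface (S : set R4) : Prop :=
  S `<=` S3 /\ forall p, S p -> exists U f, chart S U f /\ (f @` U) p.

Definition tangent (S : set R4) (p : R4) : set R4 :=
  [set v | exists U f u a,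
    [/\ chart S U f, U u, f u = p & 'd f u a = v]].

(* [w] is the Levi-Civita derivative [D_v X] at [p] of a vector field [X]
   which is only defined along [S], in the direction [v] tangent to [S]. *)
Definition covariant_derivative (S : set R4) (X : R4 -> R4) (p v w : R4) : Prop :=
  exists U f u a,
    [/\ chart S U f, U u, f u = p & 'd f u a = v] /\
    differentiable (X \o f) u /\ w = proj_S3 p ('d (X \o f) u a).

(* [div_S X (p) = d], where [div_S X = <D_e1 X, e1> + <D_e2 X, e2>] for an
   orthonormal basis [(e1, e2)] of the tangent plane of [S]. *)
Definition has_divergence (S : set R4) (X : R4 -> R4) (p : R4) (d : R) : Prop :=
  exists e1 e2 w1 w2 : R4,
    [/\ dot e1 e1 = 1, dot e2 e2 = 1 & dot e1 e2 = 0] /\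
    [/\ covariant_derivative S X p e1 w1, covariant_derivative S X p e2 w2 &
        d = dot w1 e1 + dot w2 e2].

Definition unit_normal (S : set R4) (N : R4 -> R4) : Prop :=
  {within S, continuous N} /\
  forall p, S p ->
    [/\ dot (N p) (N p) = 1, tangent_S3 p (N p) &
        forall v, tangent S p v -> dot (N p) v = 0].

Definition horizontal_part (N : R4 -> R4) (p : R4) : R4 :=
  N p - dot (N p) (V p) *: V p.

Definition nu_h (N : R4 -> R4) (p : R4) : R4 :=
  (enorm (horizontal_part N p))^-1 *: horizontal_part N p.

Definition singular_point (S : set R4) (p : R4) : Prop :=
  S p /\ tangent S p = horizontal p.

Definition has_constant_mean_curvature (S : set R4) (N : R4 -> R4) (H : R) :
    Prop :=
  forall p, S p -> has_divergence S (nu_h N) p (- 2 * H).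

(* Smoothness of a self-map of [S^3] is smoothness of an extension to an open
   neighbourhood of [S^3]; ['d F p] then restricts to its differential on
   [T_p S^3], whatever the extension. *)
Definition smooth_selfmap_S3 (F : R4 -> R4) : Prop :=
  (forall p, S3 p -> S3 (F p)) /\
  exists U, [/\ open U, S3 `<=` U & smooth_on U F].

Definition isometry_S3 (F : R4 -> R4) : Prop :=
  [/\ smooth_selfmap_S3 F,
      exists G, [/\ smooth_selfmap_S3 G,
        forall p, S3 p -> G (F p) = p & forall p, S3 p -> F (G p) = p] &
      forall p v w, S3 p -> tangent_S3 p v -> tangent_S3 p w ->
        dot ('d F p v) ('d F p w) = dot v w].

Definition preserves_horizontal (F : R4 -> R4) : Prop :=
  forall p, S3 p -> 'd F p @` horizontal p = horizontal (F p).

Definition congruent (S S' : set R4) : Prop :=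
  exists F, [/\ isometry_S3 F, preserves_horizontal F & F @` S = S'].

(* [|z_1|^2 = x_1^2 + y_1^2]. *)
Definition clifford_torus (rho : R) : set R4 :=
  [set p | S3 p /\ qre p ^+ 2 + qi p ^+ 2 = rho ^+ 2].

End Sphere.

(* Main.v *)
Require Import Defs.
From HB Require Import structures.
From mathcomp Require Import all_boot all_order all_algebra.
From mathcomp Require Import all_classical all_reals all_analysis.
From mathcomp Require Import ring lra.
Import Order.TTheory GRing.Theory Num.Theory.
Import numFieldNormedType.Exports.
Local Open Scope classical_set_scope.
Local Open Scope ring_scope.

(** Write [i p] for [V p], let [nu = nu_h N], [tau = sqrt (1 + H^2)] and
    [c = H / tau], so that [c] is irrational and [-1 < c < 1].

    Along a surface of constant mean curvature [H] without singular points, the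
    unit tangent field [Z = i nu] is horizontal, and the equation for [H] says
    exactly that [D_Z nu = i p - 2 H i nu]: the derivative of [nu] in the
    direction of [Z] is determined at every point (lemma
    [characteristic_path]).  So the integral curves of [Z] ought to be the
    sub-Riemannian geodesics of curvature [H].  In terms of the unit vector
    [Y p = (i nu + H i p) / tau], the geodesic equation is the linear system
    [p' = tau Y - H i p], [Y' = - tau p - H i Y], whose solution is explicit:
    [p(s) = e^(-iHs) (cos (tau s) p + sin (tau s) Y)] (definition [geodesic]).

    No integral curve of [Z] has to be constructed.  The graph
    [K = {(p, Y p) | p in S}] is compact and is tangent at each of its points to
    the linear vector field above, which is skew-symmetric on R^8.  Hence for a
    point [x(s)] moving with the flow and a point of [K] nearest to it, the
    inner product of the two has derivative zero, and the distance to [K]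
    cannot start to grow: a flow line which meets [K] stays in it (lemma
    [invariant_compact]).  In particular geodesics starting on [S] along [Z]
    never leave [S].

    Put [v p = conj p * Y p], a unit imaginary quaternion with [Y p = p v p].
    The geodesic through [p] is [e^(-iHs) p e^(tau s v)], a line on the torus
    [T(v) = {q | <i q, q v> = c}], [v = v p].  After a right translation which
    turns [v] into [i], the two angles of this line have velocities [tau - H]
    and [- (tau + H)].  Their ratio is irrational, so the line is dense
    ([irrational_dense], [dense_torus]).  Since [K] is closed, [T(v p)] lies in
    [S], and moreover [Y q = q v p], that is [v q = v p], on all of [T(v p)]
    (lemma [torus_in_surface]).

    It remains to see that [v] is constant.  In terms of the Hopf map
    [q |-> conj q i q], the torus [T(v)] is the preimage of the circle with
    centre [v] and angular radius [arccos c].  Two such circles whose centres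
    are close meet ([circles_meet]); at a point [q] above an intersection [v q]
    is equal to both centres.  So [v] is locally constant, hence constant on
    the connected surface [S], and [S = T(v)] (lemma [surface_torus]).  A right
    translation is an isometry which preserves the horizontal distribution; the
    one which turns [v] into [i] maps [T(v)] to the Clifford torus with
    [rho^2 = (1 + c) / 2]. *)

Set Implicit Arguments.
Unset Strict Implicit.
Unset Printing Implicit Defensive.

(** * Quaternion algebra in coordinates *)

Section Quaternion.
Context {R : realType}.
Implicit Types (a b c d k t : R) (p q r u v w : 'rV[R]_4).

Lemma quat_coords :
  ((forall a b c d, qre (quat a b c d) = a) *
   (forall a b c d, qi (quat a b c d) = b)) *
  ((forall a b c d, qj (quat a b c d) = c) *
   (forall a b c d, qk (quat a b c d) = d)).
Proof. by do ![split] => *; rewrite /qre /qi /qj /qk /quat !mxE !inordK. Qed.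

Lemma qreE :
  (forall p q, qre (p + q) = qre p + qre q) *
  (forall p, qre (- p) = - qre p) *
  (forall k p, qre (k *: p) = k * qre p) * (qre (0 : 'rV[R]_4) = 0).
Proof. by do ![split] => *; rewrite /qre !mxE. Qed.

Lemma qiE :
  (forall p q, qi (p + q) = qi p + qi q) *
  (forall p, qi (- p) = - qi p) *
  (forall k p, qi (k *: p) = k * qi p) * (qi (0 : 'rV[R]_4) = 0).
Proof. by do ![split] => *; rewrite /qi !mxE. Qed.

Lemma qjE :
  (forall p q, qj (p + q) = qj p + qj q) *
  (forall p, qj (- p) = - qj p) *
  (forall k p, qj (k *: p) = k * qj p) * (qj (0 : 'rV[R]_4) = 0).
Proof. by do ![split] => *; rewrite /qj !mxE. Qed.

Lemma qkE :
  (forall p q, qk (p + q) = qk p + qk q) *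
  (forall p, qk (- p) = - qk p) *
  (forall k p, qk (k *: p) = k * qk p) * (qk (0 : 'rV[R]_4) = 0).
Proof. by do ![split] => *; rewrite /qk !mxE. Qed.

Lemma ord4P (P : 'I_4 -> Prop) :
  P (inord 0) -> P (inord 1) -> P (inord 2) -> P (inord 3) -> forall i, P i.
Proof.
move=> P0 P1 P2 P3 i; rewrite -(inord_val i).
by case: i => -[|[|[|[|]]]].
Qed.

Lemma quat_ext p q :
  qre p = qre q -> qi p = qi q -> qj p = qj q -> qk p = qk q -> p = q.
Proof. by move=> *; apply/rowP; apply: ord4P. Qed.

Lemma dot4E p q :
  dot p q = qre p * qre q + qi p * qi q + qj p * qj q + qk p * qk q.
Proof.
rewrite /dot !big_ord_recr big_ord0 /= add0r /qre /qi /qj /qk.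
by do ![congr (_ + _)]; congr (p 0 _ * q 0 _); apply: val_inj;
  rewrite /= inordK.
Qed.

Definition qconj p := quat (qre p) (- qi p) (- qj p) (- qk p).
Definition quatI : 'rV[R]_4 := quat 0 1 0 0.

Definition qE := (quat_coords, qreE, qiE, qjE, qkE).

End Quaternion.

Ltac qring := apply: quat_ext;
  rewrite /V /E1 /E2 /quatI /qmul /qconj ?dot4E !qE; ring.
Ltac dring := rewrite /V /E1 /E2 /quatI /qmul /qconj !dot4E ?qE; ring.

Section QuaternionAlgebra.
Context {R : realType}.
Implicit Types (a b c d k t : R) (p q r u v w : 'rV[R]_4).

Lemma dotC p q : dot p q = dot q p. Proof. dring. Qed.
Lemma dotDl p q r : dot (p + q) r = dot p r + dot q r. Proof. dring. Qed.
Lemma dotDr p q r : dot r (p + q) = dot r p + dot r q. Proof. dring. Qed.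
Lemma dotZl k p q : dot (k *: p) q = k * dot p q. Proof. dring. Qed.
Lemma dotZr k p q : dot p (k *: q) = k * dot p q. Proof. dring. Qed.
Lemma dotNl p q : dot (- p) q = - dot p q. Proof. dring. Qed.
Lemma dotNr p q : dot p (- q) = - dot p q. Proof. dring. Qed.

Definition dotE := (dotDl, dotDr, dotZl, dotZr, dotNl, dotNr).

Lemma qmulA p q r : qmul p (qmul q r) = qmul (qmul p q) r. Proof. qring. Qed.
Lemma qmulDr p q r : qmul p (q + r) = qmul p q + qmul p r. Proof. qring. Qed.
Lemma qmulDl p q r : qmul (p + q) r = qmul p r + qmul q r. Proof. qring. Qed.
Lemma qmulZr k p q : qmul p (k *: q) = k *: qmul p q. Proof. qring. Qed.
Lemma qmulZl k p q : qmul (k *: p) q = k *: qmul p q. Proof. qring. Qed.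
Lemma dot_qmull r p q : dot (qmul r p) (qmul r q) = dot r r * dot p q.
Proof. dring. Qed.
Lemma dot_qmulr r p q : dot (qmul p r) (qmul q r) = dot p q * dot r r.
Proof. dring. Qed.
Lemma qconjK p q : qmul (qconj p) (qmul p q) = dot p p *: q.
Proof. qring. Qed.
Lemma qmul_conjK p q : qmul (qmul p q) (qconj q) = dot q q *: p.
Proof. qring. Qed.
Lemma qmul_conjVK p q : qmul (qmul p (qconj q)) q = dot q q *: p.
Proof. qring. Qed.
Lemma qmulK p q : qmul p (qmul (qconj p) q) = dot p p *: q.
Proof. qring. Qed.
Lemma dot_qconj p : dot (qconj p) (qconj p) = dot p p. Proof. dring. Qed.

Lemma VV p : V (V p) = - p. Proof. qring. Qed.
Lemma VD p q : V (p + q) = V p + V q. Proof. qring. Qed.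
Lemma VZ k p : V (k *: p) = k *: V p. Proof. qring. Qed.
Lemma V_skew p q : dot (V p) q = - dot p (V q). Proof. dring. Qed.
Lemma VN p : V (- p) = - V p. Proof. qring. Qed.
Lemma dot_V p q : dot (V p) (V q) = dot p q. Proof. dring. Qed.
Lemma dotV_id p : dot (V p) p = 0. Proof. dring. Qed.
Lemma V_qmul p q : V (qmul p q) = qmul (V p) q. Proof. qring. Qed.

Lemma dot_ge0 p : 0 <= dot p p.
Proof. by rewrite dot4E; do ![apply: addr_ge0]; apply: sqr_ge0. Qed.

Lemma dot_eq0 p : dot p p = 0 -> p = 0.
Proof.
rewrite dot4E => h.
have [h0 [h1 [h2 h3]]] :
  qre p = 0 /\ qi p = 0 /\ qj p = 0 /\ qk p = 0.
  have := sqr_ge0 (qre p); have := sqr_ge0 (qi p).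
  have := sqr_ge0 (qj p); have := sqr_ge0 (qk p).
  rewrite !expr2 => g3 g2 g1 g0.
  by do ![split]; apply/eqP; rewrite -sqrf_eq0 expr2; apply/eqP; lra.
by apply: quat_ext; rewrite ?qE ?h0.
Qed.

Lemma dot_unit_eq p q : dot p p = 1 -> dot q q = 1 -> dot p q = 1 -> p = q.
Proof.
move=> pp qq pq; apply/eqP; rewrite -subr_eq0; apply/eqP/dot_eq0.
by rewrite !dotE (dotC q p) pp qq pq; ring.
Qed.

End QuaternionAlgebra.

(** * Derivatives of paths in R^n *)

Section Paths.
Context {R : realType}.

Lemma is_derive_rV n (c : R -> 'rV[R]_n) (t : R) (v : 'rV[R]_n) :
  is_derive t 1 c v <-> forall j, is_derive t 1 (fun s => c s 0 j) (v 0 j).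
Proof.
split=> [[dc <-] j|h].
  apply: DeriveDef; first exact: (derivable_mxP _ _ _).1 dc 0 j.
  by rewrite derive_mx// mxE.
have dc : derivable c t 1.
  by apply/derivable_mxP => i j; rewrite ord1; have [] := h j.
apply: DeriveDef => //; rewrite derive_mx//; apply/rowP => j; rewrite mxE.
by have [_] := h j.
Qed.

Lemma is_derive_dot n (c d : R -> 'rV[R]_n) (t : R) (v w : 'rV[R]_n) :
  is_derive t 1 c v -> is_derive t 1 d w ->
  is_derive t 1 (fun s => dot (c s) (d s)) (dot v (d t) + dot (c t) w).
Proof.
move=> /is_derive_rV dc /is_derive_rV dd.
have -> : (fun s => dot (c s) (d s)) =
    \sum_(i < n) (fun s => c s 0 i * d s 0 i).
  by apply/funext => s; rewrite fct_sumE.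
rewrite /dot -big_split; apply: is_derive_sum => i.
apply: (is_derive_eq (is_deriveM (dc i) (dd i))).
by rewrite /GRing.scale /=; ring.
Qed.

Lemma rV_norm_le n (x : 'rV[R]_n) (e : R) :
  0 <= e -> (forall j, `|x 0 j| <= e) -> `|x| <= e.
Proof.
move=> e0 h; rewrite /Num.Def.normr/= mx_normrE (bigmax_le _ e0)//= => -[i j] _.
by rewrite ord1.
Qed.

Lemma cvg_rV (T : Type) (F : set_system T) {FF : Filter F} n
    (c : T -> 'rV[R]_n) (v : 'rV[R]_n) :
  (forall j, c x 0 j @[x --> F] --> v 0 j) -> c @ F --> v.
Proof.
move=> h; apply/cvgrPdist_le => e e0.
have : \forall x \near F, forall j, `|v 0 j - c x 0 j| <= e.
  apply: filter_forall => j; exact: ((cvgrPdist_le _ _).1 (h j)).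
apply: filterS => x hx; apply: rV_norm_le (ltW e0) _ => j.
by rewrite !mxE.
Qed.

Lemma cvg_rV_coord (T : Type) (F : set_system T) {FF : Filter F} n
    (c : T -> 'rV[R]_n) (v : 'rV[R]_n) j :
  c @ F --> v -> c x 0 j @[x --> F] --> v 0 j.
Proof.
move=> h.
apply: (@continuous_cvg _ _ _ F FF c (fun x : 'rV[R]_n => x 0 j) v _ h).
exact: coord_continuous.
Qed.

Lemma cvg_dot (T : Type) (F : set_system T) {FF : Filter F} n
    (c d : T -> 'rV[R]_n) (v w : 'rV[R]_n) :
  c @ F --> v -> d @ F --> w ->
  dot (c x) (d x) @[x --> F] --> dot v w.
Proof.
move=> hc hd; apply: cvg_big => [|i _]; first exact: add_continuous.
by apply: cvgM; apply: cvg_rV_coord.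
Qed.

Lemma linear_rV_coord m n (f : {linear 'rV[R]_m -> 'rV[R]_n}) x j :
  f x 0 j = dot x (row j (lin1_mx f)^T).
Proof.
rewrite -mul_rV_lin1 !mxE; apply: eq_bigr => i _; congr (_ * _).
by rewrite !mxE.
Qed.

Lemma linear_rV_continuous m n (f : {linear 'rV[R]_m -> 'rV[R]_n}) :
  continuous f.
Proof.
move=> x; apply: (@cvg_rV _ (nbhs x) _ n f (f x)) => j.
rewrite linear_rV_coord; under eq_fun do rewrite linear_rV_coord.
by apply: cvg_dot; [exact: cvg_id|exact: cvg_cst].
Qed.

Lemma is_derive_lin m n (f : {linear 'rV[R]_m -> 'rV[R]_n})
    (c : R -> 'rV[R]_m) (t : R) v :
  is_derive t 1 c v -> is_derive t 1 (fun s => f (c s)) (f v).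
Proof.
move=> dc; apply/is_derive_rV => j.
rewrite linear_rV_coord; under eq_fun do rewrite linear_rV_coord.
apply: (is_derive_eq (is_derive_dot dc (is_derive_cst _ _ _))).
by rewrite /dot [X in _ + X]big1 ?addr0// => i _; rewrite mxE mulr0.
Qed.

Lemma V_is_linear : linear (@V R).
Proof. by move=> k p q; rewrite VD VZ. Qed.

HB.instance Definition _ := GRing.isLinear.Build _ _ _ _ (@V R) V_is_linear.

Lemma is_derive_scale n (g : R -> R) (c : R -> 'rV[R]_n) (t k : R) v :
  is_derive t 1 g k -> is_derive t 1 c v ->
  is_derive t 1 (fun s => g s *: c s) (k *: c t + g t *: v).
Proof.
move=> dg /is_derive_rV dc; apply/is_derive_rV => j.
have -> : (fun s => (g s *: c s) 0 j) = g * (fun s => c s 0 j).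
  by apply/funext => s; rewrite !mxE.
apply: (is_derive_eq (is_deriveM dg (dc j))).
by rewrite !mxE /GRing.scale /=; ring.
Qed.

Lemma is_derive_chain (U W : normedModType R) (f : U -> W) (g : R -> U) 
    (t : R) (b : U) :
  differentiable f (g t) -> is_derive t 1 g b ->
  is_derive t 1 (f \o g) ('d f (g t) b).
Proof.
move=> df [dg <-]; move/derivable1_diffP : dg => dg.
have dfg := differentiable_comp dg df.
apply: DeriveDef; first exact/derivable1_diffP.
by rewrite deriveE// diff_comp// deriveE.
Qed.

Lemma is_derive_line (U : normedModType R) (u b : U) :
  is_derive (0 : R) 1 (fun h => u + h *: b) b.
Proof.
have db := is_diff_scalel (0 : R) b.
have h : is_derive (0 : R) 1 (fun h : R => h *: b) b.
  apply: DeriveDef; first exact: diff_derivable.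
  by rewrite deriveE// diff_val scale1r.
by apply: (is_derive_eq (is_deriveD (is_derive_cst u _ _) h)); rewrite add0r.
Qed.

(** Differentiates an identity which holds along a path. *)
Lemma is_derive_near_cst (f : R -> R) (t a k : R) :
  (\forall s \near t, f s = a) -> is_derive t 1 f k -> k = 0.
Proof.
move=> fa [_ <-]; rewrite (near_eq_derive _ (g := cst a))//.
exact: derive_cst.
Qed.

End Paths.

(** * Lifting a path through an immersion *)

Section Lift.
Context {R : realType}.

(** The derivative at [0] in the form of first-order estimates. *)
Lemma is_derive0P (U : normedModType R) (g : R -> U) (b : U) :
  is_derive (0 : R) 1 g b <-> forall e, 0 < e ->
    \forall h \near (0 : R), `|g h - g 0 - h *: b| <= e * `|h|.
Proof.
pose q h := h^-1 *: ((g \o shift 0) (h *: (1 : R)) - g 0).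
have qE (h : R) : h != 0 -> `|b - q h| = `|h|^-1 * `|g h - g 0 - h *: b|.
  move=> h0; rewrite /q /= addr0 [h *: 1]mulr1 distrC -normfV -normrZ.
  by rewrite [X in _ = `|X|]scalerBr scalerA mulVf// scale1r.
have qP : (q h @[h --> 0^'] --> b) <-> forall e, 0 < e ->
    \forall h \near (0 : R), `|g h - g 0 - h *: b| <= e * `|h|.
  split=> [/cvgrPdist_le qb e e0|qb].
    have := qb e e0; rewrite /dnbhs near_withinE => H.
    near=> h; have [->|h0] := eqVneq h 0.
      by rewrite subrr scale0r subr0 !normr0 mulr0.
    have : h != 0 -> `|b - q h| <= e by near: h.
    by move=> /(_ h0); rewrite qE// mulrC ler_pdivrMr// normr_gt0.
  apply/cvgrPdist_le => e e0; rewrite /dnbhs near_withinE.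
  near=> h => h0; rewrite qE// mulrC ler_pdivrMr ?normr_gt0//.
  by near: h; exact: qb.
rewrite -qP; split=> [[dg <-]//|qb].
apply: DeriveDef; first by apply/cvg_ex; exists b.
exact/cvg_lim.
Unshelve. all: by end_near. Qed.

Lemma injective_row_free m n (f : {linear 'rV[R]_m -> 'rV[R]_n}) :
  injective f -> row_free (lin1_mx f).
Proof.
move=> fI; rewrite -kermx_eq0; apply/eqP/row_matrixP => i; rewrite row0.
by apply: fI; rewrite linear0 -mul_rV_lin1 -row_mul mulmx_ker row0.
Qed.

Lemma injective_linear_rV m n (f : {linear 'rV[R]_m -> 'rV[R]_n}) :
  injective f ->
  exists g : {linear 'rV[R]_n -> 'rV[R]_m}, cancel f g.
Proof.
move=> /injective_row_free /row_freeP[B AB]; exists (mulmxr B) => x.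
by rewrite /= -mul_rV_lin1 -mulmxA AB mulmx1.
Qed.

(** If [f] is an immersion at [g 0], then a continuous [g] is
    differentiable as soon as [f \o g] is: with [`|x| <= k `|'d f x|], the error
    [y = g h - g 0 - h b] satisfies [`|y| <= k d `|y| + O(d `|h|)] for each
    [d > 0], and the first term is absorbed when [k d <= 1 / 2].  This gives
    the differentiability of changes of charts without an inverse function
    theorem. *)
Lemma is_derive_lift m n (f : 'rV[R]_m -> 'rV[R]_n) (g : R -> 'rV[R]_m)
    (b : 'rV[R]_m) :
  differentiable f (g 0) -> injective ('d f (g 0)) ->
  {for 0, continuous g} ->
  is_derive (0 : R) 1 (f \o g) ('d f (g 0) b) -> is_derive (0 : R) 1 g b.
Proof.
move=> df /injective_linear_rV[L LK] cg /is_derive0P dfg.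
have /linear_lipschitz [k k0 kL] := @linear_rV_continuous _ _ _ L.
have inj x : `|x| <= k * `|'d f (g 0) x| by rewrite -{1}(LK x) kL.
apply/is_derive0P => e e0.
(* [d] makes the coefficient of [`|y|] at most [1/2] and that of [`|h|] at most
   [e / 2] in the final estimate. *)
pose d := Num.min (k^-1 / 2) (e * k^-1 / (2 * (1 + `|b|))).
have b1 : 0 < 1 + `|b| by rewrite ltr_wpDr.
have d0 : 0 < d by rewrite lt_min !divr_gt0// !(mulr_gt0, invr_gt0).
have d1 : k * d <= 2^-1.
  by rewrite -ler_pdivlMl// /d ge_min lexx.
have d2 : k * d * (1 + `|b|) <= e / 2.
  rewrite -ler_pdivlMr// -ler_pdivlMl// /d ge_min; apply/orP; right.
  by rewrite (_ : _ / _ = k^-1 * (e / 2 / (1 + `|b|)))//; field; rewrite !gt_eqF.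
have /diff_locallyP [_ /eqaddoP /(_ d d0)] := df; rewrite /=.
move=> Hf.
have {}Hf : \forall h \near (0 : R),
   `|f (g h) - f (g 0) - 'd f (g 0) (g h - g 0)| <= d * `|g h - g 0|.
  have cg0 : g h - g 0 @[h --> (0 : R)] --> (0 : 'rV[R]_m).
    rewrite -[X in _ --> X](subrr (g 0)).
    exact: (cvgB cg (cvg_cst (g 0))).
  apply: (@filterS _ (nbhs (0 : R)) _ _ _ _ (cg0 _ Hf)) => h /=.
  by rewrite !fctE /= subrK opprD addrA.
near=> h.
have H1 : `|f (g h) - f (g 0) - 'd f (g 0) (g h - g 0)| <= d * `|g h - g 0|.
  by near: h.
have H2 : `|f (g h) - f (g 0) - h *: 'd f (g 0) b| <= d * `|h|.
  by near: h; exact: dfg.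
set y := g h - g 0 - h *: b.
have Hy := inj y.
have H3 : `|g h - g 0| <= `|y| + `|h| * `|b|.
  by rewrite -normrZ -[X in `|X| <= _](subrK (h *: b)) ler_normD.
have H4 : `|'d f (g 0) y| <= d * `|g h - g 0| + d * `|h|.
  apply: le_trans (lerD H1 H2).
  have -> : 'd f (g 0) y = - (f (g h) - f (g 0) - 'd f (g 0) (g h - g 0)) +
      (f (g h) - f (g 0) - h *: 'd f (g 0) b).
    rewrite /y linearB linearZ /= opprB.
    by rewrite addrA subrK.
  by rewrite -[X in _ <= X + _]normrN ler_normD.
have : `|y| <= k * d * `|y| + k * d * (1 + `|b|) * `|h|.
  apply: (le_trans Hy); rewrite -mulrA -mulrA -mulrA -mulrDr ler_pM2l//.
  apply: (le_trans H4); rewrite -mulrDr -mulrDr ler_pM2l//.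
  by apply: le_trans (lerD H3 (lexx _)) _; rewrite mulrDl mul1r; lra.
have := ler_wpM2r (normr_ge0 y) d1.
have := ler_wpM2r (normr_ge0 h) d2.
lra.
Unshelve. all: by end_near. Qed.

End Lift.

(** * Orthonormal frames *)

Section Frame.
Context {R : realType}.
Implicit Types (p v e : 'rV[R]_4).

Lemma quat_frame p v :
  dot p p *: v = dot v p *: p + dot v (V p) *: V p
    + dot v (E1 p) *: E1 p + dot v (E2 p) *: E2 p.
Proof. by qring. Qed.

Lemma horizontalP p v : dot p p = 1 ->
  horizontal p v <-> dot v p = 0 /\ dot v (V p) = 0.
Proof.
move=> pp; split=> [[a [b ->]]|[vp vVp]].
  by split; [rewrite !dotE|rewrite !dotE]; dring.
exists (dot v (E1 p)), (dot v (E2 p)).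
by rewrite -[LHS]scale1r -pp quat_frame vp vVp !scale0r !add0r.
Qed.

(** A horizontal unit vector [v] completes to the orthonormal frame
    [(p, i p, v, i v)] of R^4. *)
Lemma horizontal_frame p v e :
  dot p p = 1 -> dot v v = 1 -> dot v p = 0 -> dot v (V p) = 0 ->
  e = dot e p *: p + dot e (V p) *: V p + dot e v *: v + dot e (V v) *: V v.
Proof.
move=> pp vv vp vVp.
have [a [b vE]] : horizontal p v by apply/horizontalP.
have ab : a * a + b * b = 1.
  have : dot v v = (a * a + b * b) * dot p p by rewrite vE; dring.
  by rewrite vv pp mulr1.
have VE1 : V (E1 p) = E2 p by qring.
have VE2 : V (E2 p) = - E1 p by qring.
rewrite -[LHS]scale1r -{1}pp quat_frame -!addrA; do 2![congr (_ + _)].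
rewrite vE !(VD, VZ, VE1, VE2) !dotE.
move: (dot e (E1 p)) (dot e (E2 p)) (E1 p) (E2 p) => s t P Q.
rewrite -[LHS]scale1r -ab; qring.
Qed.

(** Dimension count: an injective image of R^2 inside the orthogonal plane of
    [p] and [n] fills that plane. *)
Lemma orthonormal_plane_surj (f : {linear 'rV[R]_2 -> 'rV[R]_4}) p n v :
  injective f -> dot p p = 1 -> dot n n = 1 -> dot p n = 0 ->
  (forall x, dot (f x) p = 0) -> (forall x, dot (f x) n = 0) ->
  dot v p = 0 -> dot v n = 0 -> exists x, f x = v.
Proof.
move=> fI pp nn pn fp fn vp vn.
have dotM (x y : 'rV[R]_4) : x *m y^T = (dot x y)%:M.
  apply/matrixP => i j; rewrite !ord1 !mxE mulr1n.
  by apply: eq_bigr => k _; rewrite mxE.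
pose J := lin1_mx f; pose B := col_mx p n.
have Jfree : row_free J := injective_row_free fI.
have orthP (x : 'rV[R]_4) : dot x p = 0 -> dot x n = 0 -> (x <= kermx B^T)%MS.
  move=> xp xn; apply/sub_kermxP.
  by rewrite tr_col_mx mul_mx_row !dotM xp xn !raddf0 row_mx0.
have JB : (J <= kermx B^T)%MS.
  by apply/row_subP => i; rewrite rowE mul_rV_lin1; apply: orthP.
have Bfree : \rank B = 2.
  apply/eqP; rewrite -/(row_free B); apply/row_freeP; exists B^T.
  rewrite tr_col_mx mul_col_row !dotM (dotC n p) pp nn pn !raddf0.
  by rewrite -scalar_mx_block.
have /eqmxP JE : (J == kermx B^T)%MS.
  rewrite -(geq_leqif (mxrank_leqif_eq JB)) mxrank_ker mxrank_tr Bfree.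
  by rewrite (eqP Jfree).
have /submxP [x vE] : (v <= J)%MS by rewrite JE orthP.
by exists x; rewrite vE mul_rV_lin1.
Qed.

(** The transpose of an orthogonal matrix of size 2 is orthogonal. *)
Lemma orthonormal_rows_cols (x1 y1 x2 y2 : R) :
  x1 * x1 + y1 * y1 = 1 -> x2 * x2 + y2 * y2 = 1 -> x1 * x2 + y1 * y2 = 0 ->
  x1 * x1 + x2 * x2 = 1 /\ x1 * y1 + x2 * y2 = 0.
Proof.
move=> h1 h2 h3; split.
  rewrite -[RHS]h2 [LHS]addrC; congr (_ + _).
  have h4 : x1 * x2 = - (y1 * y2) by apply/eqP; rewrite -addr_eq0 h3.
  transitivity (x1 * x1 * (x2 * x2 + y2 * y2)); first by rewrite h2 mulr1.
  transitivity ((x1 * x2) * (x1 * x2) + x1 * x1 * (y2 * y2)); first by ring.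
  rewrite h4; transitivity ((x1 * x1 + y1 * y1) * (y2 * y2)); first by ring.
  by rewrite h1 mul1r.
have -> : x1 * y1 = x1 * y1 * (x2 * x2 + y2 * y2) by rewrite h2 mulr1.
have -> : x2 * y2 = x2 * y2 * (x1 * x1 + y1 * y1) by rewrite h1 mulr1.
have -> : x1 * y1 * (x2 * x2 + y2 * y2) + x2 * y2 * (x1 * x1 + y1 * y1) =
  (x1 * x2 + y1 * y2) * (x1 * y2 + x2 * y1) by ring.
by rewrite h3 mul0r.
Qed.

End Frame.

(** * Tangent planes of a surface in the sphere *)

Section Surface.
Context {R : realType} (S : set 'rV[R]_4) (N : 'rV[R]_4 -> 'rV[R]_4).
Hypotheses (SS3 : S `<=` S3) (hN : unit_normal S N).
Implicit Types (p v : 'rV[R]_4) (U : set 'rV[R]_2).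

Lemma chart_mem U f u : chart S U f -> U u -> S (f u).
Proof.
case=> _ _ _ [W [h [_ fU _ _]]] Uu.
have : (f @` U) (f u) by exists u.
by rewrite fU => -[].
Qed.

Lemma chart_diff U f u : chart S U f -> U u -> differentiable f u.
Proof. by case=> _ [df _] _ _ Uu; exact: df. Qed.

Lemma chart_line U f u b : chart S U f -> U u ->
  [/\ f (u + (0 : R) *: b) = f u, \forall h \near (0 : R), S (f (u + h *: b)) &
      is_derive (0 : R) 1 (fun h => f (u + h *: b)) ('d f u b)].
Proof.
move=> ch Uu; have E : u + (0 : R) *: b = u by rewrite scale0r addr0.
have dl : is_derive (0 : R) 1 (fun h : R => u + h *: b) b := is_derive_line u b.
split; first by rewrite E.
  have [oU _ _ _] := ch.
  have cl : {for (0 : R), continuous (fun h : R => u + h *: b)}.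
    by apply/differentiable_continuous/derivable1_diffP; case: dl.
  have nU : nbhs (u + (0 : R) *: b) U by rewrite E; exact: open_nbhs_nbhs.
  by apply: (@filterS _ (nbhs (0 : R)) _ _ _ _ (cl _ nU)) => h; exact: chart_mem ch.
have := @is_derive_chain R _ _ f (fun h : R => u + h *: b) 0 b.
by rewrite E => /(_ (chart_diff ch Uu) dl).
Qed.

(** Derivatives along the surface can be computed in any chart in which the
    field is known to be differentiable, for any differentiable path of the
    surface, even one produced by another chart.  The path in the parameter
    domain is [g \o c] with [g] the inverse of the chart; its differentiability
    comes from [is_derive_lift]. *)
Lemma is_derive_along U f u b (X : 'rV[R]_4 -> 'rV[R]_4) (c : R -> 'rV[R]_4) :
  chart S U f -> U u -> differentiable (X \o f) u ->
  c 0 = f u -> (\forall h \near (0 : R), S (c h)) ->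
  is_derive (0 : R) 1 c ('d f u b) ->
  is_derive (0 : R) 1 (X \o c) ('d (X \o f) u b).
Proof.
move=> ch Uu dX c0 Sc dc.
have [oU _ /(_ _ Uu) dfI [W [g [oW fU gK cg]]]] := ch.
have cc : {for (0 : R), continuous c}.
  by apply/differentiable_continuous/derivable1_diffP; case: dc.
have SWc0 : (S `&` W) (c 0) by rewrite c0 -fU; exists u.
have SWc : \forall h \near (0 : R), (S `&` W) (c h).
  have nW : nbhs (c 0) W by apply: open_nbhs_nbhs; split => //; case: SWc0.
  by near=> h; split; near: h => //; exact: cc _ nW.
have gc0 : g (c 0) = u by rewrite c0 gK// inE.
have cgc : {for (0 : R), continuous (g \o c)}.
  have /subspace_continuousP /(_ _ SWc0) H := cg.
  move=> A nA; have HA := cc _ (H _ nA).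
  by apply: (@filterS2 _ (nbhs (0 : R)) _ _ _ _ _ SWc HA) => h SWh /(_ SWh).
have fgc : \forall h \near (0 : R), c h = (f \o (g \o c)) h.
  apply: filterS SWc => h; rewrite -fU => -[x Ux fx]; rewrite /= -fx.
  by rewrite gK// inE.
have dgc : is_derive (0 : R) 1 (g \o c) b.
  have := @is_derive_lift R _ _ f (g \o c) b.
  rewrite [(g \o c) 0]gc0 => /(_ (chart_diff ch Uu) dfI cgc); apply.
  exact: near_eq_is_derive fgc dc.
have := @is_derive_chain R _ _ (X \o f) (g \o c) 0 b.
rewrite [(g \o c) 0]gc0 => /(_ dX dgc); apply: near_eq_is_derive.
by apply: filterS fgc => h /= <-.
Unshelve. all: by end_near. Qed.

Lemma tangent_sphere U f u b : chart S U f -> U u -> dot ('d f u b) (f u) = 0.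
Proof.
move=> ch Uu; have [E Sl dl] := chart_line b ch Uu.
have := is_derive_near_cst _ (is_derive_dot dl dl) => /(_ 1).
rewrite E => H; have : dot ('d f u b) (f u) + dot (f u) ('d f u b) = 0.
  by apply: H; apply: filterS Sl => h /SS3.
by rewrite (dotC (f u)); lra.
Qed.

Lemma chart_tangent U f u b : chart S U f -> U u -> tangent S (f u) ('d f u b).
Proof. by move=> ch Uu; exists U, f, u, b. Qed.

Lemma chart_surj U f u v : chart S U f -> U u ->
  dot v (f u) = 0 -> dot v (N (f u)) = 0 -> exists b, 'd f u b = v.
Proof.
move=> ch Uu vp vn; have Sp := chart_mem ch Uu.
have [nn np nT] := (hN.2 _ Sp).
have [_ _ /(_ _ Uu) dfI _] := ch.
apply: (@orthonormal_plane_surj _ _ (f u) (N (f u))) => //.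
- exact: (SS3 Sp).
- by rewrite dotC.
- by move=> x; exact: (tangent_sphere x ch Uu).
- by move=> x; rewrite dotC nT//; exact: (chart_tangent x ch Uu).
Qed.

Hypotheses (Sch : forall p, S p -> exists U f, chart S U f /\ (f @` U) p)
  (Sns : forall p, ~ singular_point S p).

(** If the horizontal part of the normal vanished, the normal would be a
    multiple of [V p] and the tangent plane would be horizontal. *)
Lemma horizontal_part_neq0 p : S p -> horizontal_part N p != 0.
Proof.
move=> Sp; apply/eqP => h0; apply: (Sns (p := p)); split=> //.
have pp : dot p p = 1 := SS3 Sp.
have [nn np nT] := (hN.2 _ Sp).
pose d := dot (N p) (V p).
have NE : N p = d *: V p by apply/eqP; rewrite -subr_eq0 -/(horizontal_part N p) h0.
have d0 : d != 0.
  apply: contra_eq_neq nn => d0.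
  by rewrite NE d0 dotZl mul0r eq_sym oner_neq0.
have [U [f [ch [u Uu fu]]]] := Sch Sp.
apply/seteqP; split=> v.
  move=> Tv; apply/horizontalP => //; split.
    case: (Tv) => [U' [f' [u' [a [ch' Uu' fu' <-]]]]].
    by rewrite -fu'; exact: (tangent_sphere a ch' Uu').
  by have := nT _ Tv; rewrite NE dotZl dotC => /eqP; rewrite mulf_eq0 (negPf d0) => /eqP.
move/horizontalP => -[//|vp vV].
have [b <-] : exists b, 'd f u b = v.
  by apply: (chart_surj ch Uu); rewrite fu// NE dotZr vV mulr0.
by rewrite -fu; exact: (chart_tangent b ch Uu).
Qed.

(** Here [g = |N_h|] and [d = <N, V>]. *)
Lemma nu_h_spec p : S p ->
  [/\ dot (nu_h N p) (nu_h N p) = 1, dot (nu_h N p) p = 0,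
      dot (nu_h N p) (V p) = 0 &
      exists g d : R, N p = g *: nu_h N p + d *: V p /\ g * g + d * d = 1].
Proof.
move=> Sp; have pp : dot p p = 1 := SS3 Sp.
have [nn np nT] := (hN.2 _ Sp).
have h0 := horizontal_part_neq0 Sp.
set w := horizontal_part N p in h0 *.
have ww : 0 < dot w w.
  by rewrite lt_neqAle dot_ge0 andbT eq_sym; apply: contra_neq h0 => /dot_eq0.
have VpVp : dot (V p) (V p) = 1 by rewrite dot_V.
have wV : dot w (V p) = 0 by rewrite /w /horizontal_part !dotE VpVp mulr1 subrr.
have wp : dot w p = 0 by rewrite /w /horizontal_part !dotE np dotV_id; ring.
have nuE : nu_h N p = (enorm w)^-1 *: w by [].
have wNE : N p = w + dot (N p) (V p) *: V p by rewrite subrK.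
clearbody w.
have e0 : 0 < enorm w by rewrite sqrtr_gt0.
have ee : enorm w * enorm w = dot w w by rewrite -expr2 sqr_sqrtr// ltW.
have wE : w = enorm w *: nu_h N p by rewrite nuE scalerA divff ?gt_eqF// scale1r.
have nunu : dot (nu_h N p) (nu_h N p) = 1.
  by rewrite nuE !dotE -ee; field; rewrite gt_eqF.
have nuV : dot (nu_h N p) (V p) = 0 by rewrite nuE !dotE wV mulr0.
split=> //; first by rewrite nuE !dotE wp mulr0.
exists (enorm w), (dot (N p) (V p)).
have NE : N p = enorm w *: nu_h N p + dot (N p) (V p) *: V p.
  by rewrite -wE.
split => //; move: NE nunu nuV.
move: (nu_h N p) (dot (N p) (V p)) (enorm w) => n d g NE nunu nuV.
by rewrite -nn NE !(dotDl, dotDr, dotZl, dotZr) nunu VpVp (dotC (V p)) nuV; ring.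
Qed.

End Surface.

(** * Constant mean curvature along the characteristic direction *)

Section TraceReduction.
Context {R : realType}.

(** The tangent plane is spanned by [Z = V n] and [T = d n - g (V p)].  The
    identities satisfied by [D] come from differentiating [|n|^2 = 1],
    [<n, V p> = 0] and [<n, p> = 0]; they give [<D_T n, T> = g^2 <n, p> = 0], so
    that the trace, which is the same in every orthonormal basis, reduces to
    [<D_Z n, Z>].  They also fix the three other components of [D_Z n] in the
    frame [(p, V p, n, V n)]. *)
Lemma trace_reduction (p n m e1 e2 : 'rV[R]_4) (g d : R)
    (A D : {linear 'rV[R]_2 -> 'rV[R]_4}) b1 b2 :
  dot p p = 1 -> dot n n = 1 -> dot n p = 0 -> dot n (V p) = 0 ->
  m = g *: n + d *: V p -> g * g + d * d = 1 -> injective A ->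
  (forall v, dot v p = 0 -> dot v m = 0 -> exists b, A b = v) ->
  (forall b, [/\ dot (A b) p = 0, dot (A b) m = 0, dot (D b) n = 0,
    dot (D b) (V p) = - dot n (V (A b)) & dot (D b) p = - dot n (A b)]) ->
  A b1 = e1 -> A b2 = e2 ->
  dot e1 e1 = 1 -> dot e2 e2 = 1 -> dot e1 e2 = 0 ->
  exists b, A b = V n /\
    D b = V p + (dot (D b1) e1 + dot (D b2) e2) *: V n.
Proof.
move=> pp nn np nV mE gd AI surj AD be1 be2 e11 e22 e12.
pose Z := V n; pose T := d *: n - g *: V p.
have ZZ : dot Z Z = 1 by rewrite dot_V.
have Zp : dot Z p = 0 by rewrite V_skew nV oppr0.
have Zn : dot Z n = 0 by rewrite dotV_id.
have ZV : dot Z (V p) = 0 by rewrite dot_V.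
have VV1 : dot (V p) (V p) = 1 by rewrite dot_V.
have Vp : dot (V p) p = 0 by rewrite dotV_id.
have Zm : dot Z m = 0 by rewrite mE dotDr !dotZr Zn ZV; ring.
have Tp : dot T p = 0 by rewrite /T dotDl dotNl !dotZl np Vp; ring.
have Tm : dot T m = 0.
  by rewrite mE /T !dotE nn nV VV1 (dotC (V p)) nV; ring.
have ZT : dot Z T = 0 by rewrite /T dotDr dotNr !dotZr Zn ZV; ring.
have TT : dot T T = 1.
  by rewrite -gd /T !dotE nn VV1 (dotC (V p)) nV; ring.
have [bZ dbZ] := surj _ Zp Zm.
have [bT dbT] := surj _ Tp Tm.
have decomp e : dot e p = 0 -> dot e m = 0 ->
    e = dot e Z *: Z + dot e T *: T.
  move=> ep em; rewrite [LHS](horizontal_frame e pp nn np nV) ep scale0r add0r.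
  have : g * dot e n + d * dot e (V p) = 0 by rewrite -[RHS]em mE !dotE.
  have -> : dot e T = d * dot e n - g * dot e (V p) by rewrite !dotE.
  rewrite -/Z /T; move: (dot e n) (dot e (V p)) (dot e Z) => x y z xy.
  have xE : (d * x - g * y) * d = x.
    transitivity ((g * g + d * d) * x - g * (g * x + d * y)); first by ring.
    by rewrite gd xy; ring.
  have yE : (d * x - g * y) * g = - y.
    transitivity (- (g * g + d * d) * y + d * (g * x + d * y)); first by ring.
    by rewrite gd xy; ring.
  by rewrite scalerBr !scalerA xE yE; move: (Z) (V p) => P Q; qring.
have [[Ap1 Am1 _ _ _] [Ap2 Am2 _ _ _]] := (AD b1, AD b2).
have {}decomp b : dot (A b) p = 0 -> dot (A b) m = 0 ->
    A b = dot (A b) Z *: Z + dot (A b) T *: T /\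
    D b = dot (A b) Z *: D bZ + dot (A b) T *: D bT.
  move=> bp bm; have E := decomp _ bp bm; split => //.
  rewrite -!linearZ -linearD; congr (D _); apply: AI.
  by rewrite linearD !linearZ /= dbZ dbT.
have [E1 D1] := decomp _ Ap1 Am1; have [E2 D2] := decomp _ Ap2 Am2.
rewrite be1 in E1 D1; rewrite be2 in E2 D2.
have [_ _ Zn' ZV' Zp'] := AD bZ; have [_ _ Tn' TV' Tp'] := AD bT.
have DTT : dot (D bT) T = 0.
  have VT : V T = d *: Z + g *: p by rewrite /T /Z; qring.
  rewrite [in dot _ T]/T dotDr dotNr !dotZr Tn' TV' dbT VT.
  by rewrite dotDr !dotZr (dotC n Z) Zn np; ring.
clearbody T.
have dotZT a b a' b' :
    dot (a *: Z + b *: T) (a' *: Z + b' *: T) = a * a' + b * b'.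
  by rewrite !(dotDl, dotDr, dotZl, dotZr) ZZ TT (dotC T) ZT; ring.
have [xx xy] := @orthonormal_rows_cols R (dot e1 Z) (dot e1 T)
   (dot e2 Z) (dot e2 T)
   ltac:(by rewrite -dotZT -E1) ltac:(by rewrite -dotZT -E2)
   ltac:(by rewrite -dotZT -E1 -E2).
have -> : dot (D b1) e1 + dot (D b2) e2 = dot (D bZ) Z.
  have F e b x y : e = x *: Z + y *: T -> D b = x *: D bZ + y *: D bT ->
      dot (D b) e = x * x * dot (D bZ) Z +
        x * y * (dot (D bZ) T + dot (D bT) Z).
    by move=> -> ->; rewrite !(dotDl, dotDr, dotZl, dotZr) DTT; ring.
  rewrite (F _ _ _ _ E1 D1) (F _ _ _ _ E2 D2) addrACA -!mulrDl xx xy; ring.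
exists bZ; split=> //.
rewrite [LHS](horizontal_frame _ pp nn np nV) Zn' ZV' Zp' dbZ VV.
by rewrite (dotC n) Zn dotNr nn oppr0 opprK !scale0r scale1r add0r addr0.
Qed.

End TraceReduction.

Section Characteristic.
Context {R : realType} (S : set 'rV[R]_4) (N : 'rV[R]_4 -> 'rV[R]_4) (H : R).
Hypotheses (SS3 : S `<=` S3) (hN : unit_normal S N)
  (Sch : forall p, S p -> exists U f, chart S U f /\ (f @` U) p)
  (Sns : forall p, ~ singular_point S p)
  (hH : has_constant_mean_curvature S N H).
Local Notation nu := (nu_h N).
Implicit Types (p v : 'rV[R]_4) (U : set 'rV[R]_2).

Lemma diff_nu U f u b : chart S U f -> U u -> differentiable (nu \o f) u ->
  let p := f u in let v := 'd f u b in let w := 'd (nu \o f) u b in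
  [/\ dot w (nu p) = 0, dot w (V p) = - dot (nu p) (V v) &
      dot w p = - dot (nu p) v].
Proof.
move=> ch Uu dnu p v w; have [c0 Sc dc] := chart_line b ch Uu.
have dn : is_derive (0 : R) 1 (nu \o (fun h => f (u + h *: b))) w.
  exact: (is_derive_along ch).
split.
- have := is_derive_near_cst _ (is_derive_dot dn dn) => /(_ 1).
  rewrite /= c0 => A; have : dot w (nu p) + dot (nu p) w = 0.
    apply: A; apply: filterS Sc => h Sh.
    by have [] := nu_h_spec SS3 hN Sch Sns Sh.
  by rewrite (dotC (nu p)); lra.
- have := is_derive_near_cst _ (is_derive_dot dn (is_derive_lin (@V R) dc)).
  rewrite /= c0 => /(_ 0) A; apply/eqP; rewrite -addr_eq0; apply/eqP/A.
  by apply: filterS Sc => h Sh; have [] := nu_h_spec SS3 hN Sch Sns Sh.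
- have := is_derive_near_cst _ (is_derive_dot dn dc).
  rewrite /= c0 => /(_ 0) A; apply/eqP; rewrite -addr_eq0; apply/eqP/A.
  by apply: filterS Sc => h Sh; have [] := nu_h_spec SS3 hN Sch Sns Sh.
Qed.

(** The surface contains, to first order, the geodesic of curvature [H] which
    leaves [p] in the direction [V (nu p)]: this is all that the invariance
    argument needs to know about the mean curvature. *)
Lemma characteristic_path p : S p -> exists c : R -> 'rV[R]_4,
  [/\ c 0 = p, \forall h \near (0 : R), S (c h),
      is_derive (0 : R) 1 c (V (nu p)) &
      is_derive (0 : R) 1 (nu \o c) (V p - (2 * H) *: V (nu p))].
Proof.
move=> Sp; have pp : dot p p = 1 := SS3 Sp.
have [nn np nV [g [d [NE gd]]]] := nu_h_spec SS3 hN Sch Sns Sp.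
have [NN Np NT] := hN.2 _ Sp.
have [e1 [e2 [w1 [w2 [[e11 e22 e12] [dw1 dw2 tr]]]]]] := hH Sp.
have {dw1} [U [f [u [a1 [[ch Uu fu da1] [dnu w1E]]]]]] := dw1.
have {dw2} [U2 [f2 [u2 [a2 [[ch2 Uu2 fu2 da2] [dnu2 w2E]]]]]] := dw2.
pose D b := 'd (nu \o f) u b.
have D_spec b : [/\ dot (D b) (nu p) = 0,
    dot (D b) (V p) = - dot (nu p) (V ('d f u b)) &
    dot (D b) p = - dot (nu p) ('d f u b)].
  by have := diff_nu b ch Uu dnu; rewrite /= fu.
have tan0 b : dot ('d f u b) p = 0 by rewrite -fu (tangent_sphere SS3 b ch Uu).
have tanN b : dot ('d f u b) (N p) = 0.
  by rewrite dotC NT// -fu; exact: (chart_tangent b ch Uu).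
have e2p : dot e2 p = 0 by rewrite -da2 -fu2 (tangent_sphere SS3 a2 ch2 Uu2).
have e2N : dot e2 (N p) = 0.
  by rewrite dotC NT// -da2 -fu2; exact: (chart_tangent a2 ch2 Uu2).
have surj v : dot v p = 0 -> dot v (N p) = 0 -> exists b, 'd f u b = v.
  by move=> vp vN; apply: (chart_surj SS3 hN ch Uu); rewrite fu.
(* The mean curvature involves two charts, one for each vector of the
   basis; the second derivative is transported to the first chart. *)
have [b2 db2] := surj _ e2p e2N.
have Db2 : 'd (nu \o f2) u2 a2 = D b2.
  have [c0 Sc dc] := chart_line a2 ch2 Uu2.
  have d1 := is_derive_along ch2 Uu2 dnu2 c0 Sc dc.
  have d2 : is_derive (0 : R) 1 (nu \o (fun h => f2 (u2 + h *: a2))) (D b2).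
    apply: (is_derive_along ch Uu dnu); [by rewrite c0 fu fu2|exact: Sc|].
    by rewrite db2 -da2; exact: dc.
  case: d1 => _ v1; case: d2 => _ v2; exact: etrans (esym v1) v2.
have AI : injective ('d f u) by case: ch => _ _ /(_ _ Uu).
have [b [Ab Db]] := @trace_reduction _ p (nu p) (N p) e1 e2 g d
  ('d f u) ('d (nu \o f) u) a1 b2 pp nn np nV NE gd AI surj
  (fun b => let: And3 x y z := D_spec b in And5 (tan0 b) (tanN b) x y z)
  da1 db2 e11 e22 e12.
have e1p : dot e1 p = 0 by rewrite -da1.
have projE w e : dot e p = 0 -> dot (proj_S3 p w) e = dot w e.
  by move=> ep; rewrite /proj_S3 !dotE (dotC p) ep; ring.
have trE : dot ('d (nu \o f) u a1) e1 + dot ('d (nu \o f) u b2) e2 = - 2 * H.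
  have {}w2E : w2 = proj_S3 p (D b2) := etrans w2E (congr1 (proj_S3 p) Db2).
  rewrite tr w1E w2E (projE _ _ e1p) (projE _ _ e2p); exact: erefl.
have [c0 Sc dc] := chart_line b ch Uu.
exists (fun h => f (u + h *: b)); split; first by rewrite c0.
- exact: Sc.
- by rewrite -Ab; exact: dc.
- have -> : V p - (2 * H) *: V (nu p) = D b by rewrite /D Db trE -scaleNr mulNr.
  exact: (is_derive_along ch Uu dnu c0 Sc dc).
Qed.

End Characteristic.

(** * The geodesic flow and compact sets tangent to it *)

Section Flow.
Context {R : realType}.
Implicit Types (p q y : 'rV[R]_4).

Lemma is_derive_affine (U : normedModType R) (f : R -> U) (t b : R) v :
  is_derive t 1 f v -> is_derive (0 : R) 1 (fun h => f (t + h * b)) (b *: v).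
Proof.
move=> [df <-]; have dl := is_derive_line t b.
have := @is_derive_chain R R U f (fun h : R => t + h *: b) 0 b.
rewrite scale0r addr0 => /(_ _ dl) H.
have {}H := H ((derivable1_diffP _ _).1 df).
apply: (is_derive_eq H).
by rewrite deriveE; [rewrite -linearZ /= [_ *: _]mulr1|exact/derivable1_diffP].
Qed.

Lemma is_derive_cosM (k t : R) :
  is_derive t 1 (fun s => cos (k * s)) (- (k * sin (k * t))).
Proof.
have d1 : is_derive t 1 (fun s => k * s) k.
  by apply: (is_derive_eq (is_deriveM (is_derive_cst k t 1) (is_derive_id t 1)));
     rewrite scaler0 addr0 [_ *: _]mulr1.
apply: (is_derive_eq (is_derive1_comp (is_derive_cos _) d1)).
by rewrite /=; ring.
Qed.

Lemma is_derive_sinM (k t : R) :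
  is_derive t 1 (fun s => sin (k * s)) (k * cos (k * t)).
Proof.
have d1 : is_derive t 1 (fun s => k * s) k.
  by apply: (is_derive_eq (is_deriveM (is_derive_cst k t 1) (is_derive_id t 1)));
     rewrite scaler0 addr0 [_ *: _]mulr1.
apply: (is_derive_eq (is_derive1_comp (is_derive_sin _) d1)).
by rewrite /=; ring.
Qed.

Variables (H tau : R).

(** [e^(-iHs) (cos (tau s) p + sin (tau s) y)], the solution of
    [p' = tau y - H i p], [y' = - tau p - H i y]; the second component of the
    solution is [geodesic y (- p)]. *)
Definition geodesic p y (s : R) : 'rV[R]_4 :=
  let a := cos (tau * s) *: p + sin (tau * s) *: y in
  cos (H * s) *: a - sin (H * s) *: V a.

Lemma geodesic0 p y : geodesic p y 0 = p.
Proof.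
by rewrite /geodesic !mulr0 cos0 sin0 !scale0r subr0 addr0 !scale1r.
Qed.

Lemma geodesicN p y s : geodesic (- p) (- y) s = - geodesic p y s.
Proof.
by rewrite /geodesic !(VD, VZ, VN); move: (V p) (V y) => vp vy; qring.
Qed.

(** The linear system is skew-symmetric, so its flow is isometric on R^8. *)
Lemma geodesic_norm p y s :
  dot (geodesic p y s) (geodesic p y s) +
    dot (geodesic y (- p) s) (geodesic y (- p) s) =
  dot p p + dot y y.
Proof.
pose a := cos (tau * s) *: p + sin (tau * s) *: y.
pose b := cos (tau * s) *: y - sin (tau * s) *: p.
have rot x : dot (cos (H * s) *: x - sin (H * s) *: V x)
    (cos (H * s) *: x - sin (H * s) *: V x) = dot x x.
  rewrite -[RHS]mul1r -(cos2Dsin2 (H * s)) !expr2; dring.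
have -> : geodesic y (- p) s = cos (H * s) *: b - sin (H * s) *: V b.
  by rewrite /geodesic scalerN.
rewrite [geodesic p y s]/geodesic -/a !rot /a /b.
rewrite -[RHS]mul1r -(cos2Dsin2 (tau * s)) !expr2; dring.
Qed.

Lemma is_derive_geodesic p y (s : R) : is_derive s 1 (geodesic p y)
  (tau *: geodesic y (- p) s - H *: V (geodesic p y s)).
Proof.
have da : is_derive s 1 (fun s => cos (tau * s) *: p + sin (tau * s) *: y)
    (tau *: (cos (tau * s) *: y - sin (tau * s) *: p)).
  have d1 := is_derive_scale (is_derive_cosM tau s) (is_derive_cst p s 1).
  have d2 := is_derive_scale (is_derive_sinM tau s) (is_derive_cst y s 1).
  apply: (is_derive_eq (is_deriveD d1 d2)) => /=.
  by rewrite !scaler0 !addr0 scalerBr !scalerA scaleNr addrC.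
have d1 := is_derive_scale (is_derive_cosM H s) da.
have d2 := is_derive_scale (is_derive_sinM H s) (is_derive_lin (@V R) da).
apply: (is_derive_eq (is_deriveB d1 d2)); rewrite /geodesic.
move: (cos (tau * s)) (sin (tau * s)) (cos (H * s)) (sin (H * s)) => c d e f.
rewrite /= !(VD, VZ, VN, VV).
by move: (V p) (V y) => vp vy; qring.
Qed.

(** Let [G s k] be the inner product in R^8 of the flow line at time [s] with
    [k].  All vectors involved have square norm 2, so [G s k = 2] exactly when
    the flow line is at [k] at time [s].  If it is outside [K] at time [b],
    then [G b] is at most [2 - 2 e] on [K] for some [e > 0], and
    [G (b t) k + e t] has on [[0, 1] x K] a maximum with [t < 1].  Moving [t]
    forward and [k] along the path tangent to the flow leaves [G] unchanged
    to first order, because the system is skew-symmetric, but increases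
    [e t]: a contradiction. *)
Lemma invariant_compact (K : set ('rV[R]_4 * 'rV[R]_4)) :
  compact K ->
  (forall q y, K (q, y) -> dot q q = 1 /\ dot y y = 1) ->
  (forall q y, K (q, y) -> exists c z : R -> 'rV[R]_4,
    [/\ c 0 = q, z 0 = y, \forall h \near (0 : R), K (c h, z h),
      is_derive (0 : R) 1 c (tau *: y - H *: V q) &
      is_derive (0 : R) 1 z (- (tau *: q) - H *: V y)]) ->
  forall q y, K (q, y) -> forall s, K (geodesic q y s, geodesic y (- q) s).
Proof.
move=> cK K1 Kpath q0 y0 K0 b.
have [q01 y01] := K1 _ _ K0.
pose G (s : R) (k : 'rV[R]_4 * 'rV[R]_4) :=
  dot (geodesic q0 y0 s) k.1 + dot (geodesic y0 (- q0) s) k.2.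
have G0 : G 0 (q0, y0) = 2 by rewrite /G /= !geodesic0 q01 y01; ring.
have Gle s k : K k -> 2 <= G s k -> k = (geodesic q0 y0 s, geodesic y0 (- q0) s).
  case: k => q y Kk; have [q1 y1] := K1 _ _ Kk; rewrite /G /= => Gsk.
  have N : dot (geodesic q0 y0 s) (geodesic q0 y0 s) +
      dot (geodesic y0 (- q0) s) (geodesic y0 (- q0) s) = 2.
    by rewrite geodesic_norm q01 y01; ring.
  move: Gsk N; move: (geodesic q0 y0 s) (geodesic y0 (- q0) s) => P Y Gsk N.
  have E : dot (P - q) (P - q) + dot (Y - y) (Y - y) <= 0.
    rewrite !dotE (dotC q P) (dotC y Y) q1 y1; lra.
  have P0 := dot_ge0 (P - q); have Y0 := dot_ge0 (Y - y).
  have PE : P - q = 0 by apply: dot_eq0; lra.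
  have YE : Y - y = 0 by apply: dot_eq0; lra.
  by rewrite -(subrK q P) -(subrK y Y) PE YE !add0r.
have co s p y : {for s, continuous (geodesic p y)}.
  apply/differentiable_continuous/derivable1_diffP.
  by case: (is_derive_geodesic p y s).
have cG (a e : R) : continuous (fun x : R * ('rV[R]_4 * 'rV[R]_4) =>
    G (a * x.1) x.2 + e * x.1).
  move=> x; have c1 : y.1 @[y --> x] --> x.1 by exact: cvg_fst.
  have c2 : y.2 @[y --> x] --> x.2 by exact: cvg_snd.
  have ca : a * y.1 @[y --> x] --> a * x.1 by apply: cvgM => //; exact: cvg_cst.
  have c21 : y.2.1 @[y --> x] --> x.2.1.
    exact: (cvg_comp _ _ c2 cvg_fst).
  have c22 : y.2.2 @[y --> x] --> x.2.2.
    exact: (cvg_comp _ _ c2 cvg_snd).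
  apply: cvgD; last by apply: cvgM => //; exact: cvg_cst.
  apply: cvgD; apply: cvg_dot => //.
    exact: (cvg_comp _ _ ca (co (a * x.1) q0 y0)).
  exact: (cvg_comp _ _ ca (co (a * x.1) y0 (- q0))).
have [k1 k1K Gmax] : exists2 k, k \in K & forall t, t \in K -> G b t <= G b k.
  apply: compact_EVT_max => //; first by exists (q0, y0).
  apply: continuous_subspaceT => k.
  apply: cvgD; apply: cvg_dot; first exact: cvg_cst.
  - exact: cvg_fst.
  - exact: cvg_cst.
  - exact: cvg_snd.
have [Gb2|Gb2] := lerP 2 (G b k1).
  have Kk1 : K k1 := set_mem k1K.
  by rewrite -(Gle _ _ Kk1 Gb2).
pose e := (2 - G b k1) / 2.
have e0 : 0 < e by rewrite /e; lra.
pose D := `[(0 : R), 1] `*` K.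
have cD : compact D by apply: compact_setX => //; exact: segment_compact.
have D0 : D !=set0 by exists (0, (q0, y0)); split => //=; rewrite in_itv /= lexx ler01.
have [[t [q y]] /set_mem [/= t01 Kqy] max] :=
  compact_EVT_max D0 cD (continuous_subspaceT (cG b e)).
have m0 : 2 <= G (b * t) (q, y) + e * t.
  have D00 : (0 : R, (q0, y0)) \in D.
    by rewrite inE; split => //=; rewrite in_itv /= lexx ler01.
  by have := max _ D00; rewrite /= !mulr0 addr0 G0.
move: t01; rewrite in_itv /= => /andP[t0].
rewrite le_eqVlt => /orP[/eqP t1|t1].
  have : G b (q, y) <= G b k1 by apply: Gmax; exact: mem_set.
  by move: m0; rewrite t1 !mulr1 /e; lra.
have [c [z [c0 z0 Kcz dc dz]]] := Kpath _ _ Kqy.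
have dP := is_derive_affine b (is_derive_geodesic q0 y0 (b * t)).
have dY := is_derive_affine b (is_derive_geodesic y0 (- q0) (b * t)).
have dcb : is_derive (0 : R) 1 (fun h => c (0 + h * b))
    (b *: (tau *: y - H *: V q)) := is_derive_affine b dc.
have dzb : is_derive (0 : R) 1 (fun h => z (0 + h * b))
    (b *: (- (tau *: q) - H *: V y)) := is_derive_affine b dz.
have dG := is_deriveD (is_derive_dot dP dcb) (is_derive_dot dY dzb).
set v := (X in is_derive _ _ _ X) in dG.
(* the skew-symmetry of the system *)
have v0 : v = 0.
  rewrite /v !mul0r !addr0 c0 z0 geodesicN.
  move: (geodesic q0 y0 (b * t)) (geodesic y0 (- q0) (b * t)) => P Y.
  rewrite !dotE (V_skew P) (V_skew Y); ring.
have /is_derive0P /(_ (e / 2)) := dG; rewrite divr_gt0// v0 => /(_ isT) near_le.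
have nb0 : h * b @[h --> (0 : R)] --> (0 : R).
  by rewrite -[X in _ --> X](mul0r b); apply: cvgM; [exact: cvg_id|exact: cvg_cst].
have Kb := nb0 _ Kcz.
have Kb' : \forall h \near (0 : R)^'+, K (c (h * b), z (h * b)).
  by apply: cvg_within; exact: Kb.
have near_le' : \forall h \near (0 : R)^'+,
    `|(fun h : R => G (b * t + h * b) (c (0 + h * b), z (0 + h * b))) h -
    G (b * t + 0 * b) (c (0 + 0 * b), z (0 + 0 * b)) - h *: 0| <= e / 2 * `|h|.
  by apply: cvg_within; exact: near_le.
near (0 : R)^'+ => h.
have h0 : 0 < h by near: h; exact: nbhs_right_gt.
have h1 : t + h <= 1.
  by rewrite addrC -lerBrDr; near: h; apply: nbhs_right_le; rewrite subr_gt0.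
have B : K (c (h * b), z (h * b)) by near: h.
have A : `|G (b * t + h * b) (c (h * b), z (h * b)) - G (b * t) (q, y)|
    <= e / 2 * h.
  rewrite -[X in _ <= _ * X](gtr0_norm h0).
  have : `|(fun h : R => G (b * t + h * b) (c (0 + h * b), z (0 + h * b))) h -
    G (b * t + 0 * b) (c (0 + 0 * b), z (0 + 0 * b)) - h *: 0| <= e / 2 * `|h|.
    by near: h.
  by rewrite scaler0 subr0 !mul0r !add0r addr0 c0 z0.
have C : G (b * t + h * b) (c (h * b), z (h * b)) + e * (t + h) <=
    G (b * t) (q, y) + e * t.
  have Dh : (t + h, (c (h * b), z (h * b))) \in D.
    rewrite inE; split => //=; rewrite in_itv /= h1 andbT.
    by apply: addr_ge0 => //; exact: ltW.
  by have := max _ Dh; rewrite /= mulrDr (mulrC b h).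
have eh : 0 < e * h by rewrite mulr_gt0.
move: A; rewrite ler_norml => /andP[A _].
by move: A C; rewrite mulrDr; lra.
Unshelve. all: by end_near. 
Qed.

End Flow.

(** * Irrational lines and rotations *)

Section Kronecker.
Context {R : realType}.

(** The subgroup [Z x + Z] of the reals has arbitrarily small positive
    elements: otherwise it would have a least positive element [g1], and [x]
    and [1] would both be multiples of [g1]. *)
Lemma irrational_dense (x : R) : irrational x ->
  forall (y e : R), 0 < e -> exists n m : int, `|n%:~R * x + m%:~R - y| < e.
Proof.
move=> xirr.
pose G := [set g : R | exists n m : int, g = n%:~R * x + m%:~R].
have G1 : G 1 by exists 0, 1; rewrite mul0r add0r.
have GB g h : G g -> G h -> G (g - h).
  move=> [n [m ->]] [n' [m' ->]]; exists (n - n'), (m - m').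
  by rewrite !intrB; ring.
have GM g (k : int) : G g -> G (k%:~R * g).
  by move=> [n [m ->]]; exists (k * n), (k * m); rewrite !intrM; ring.
have small e : 0 < e -> exists2 g, G g & 0 < g < e.
  move=> e0; apply: contrapT => nG.
  have {}nG g : G g -> 0 < g -> e <= g.
    move=> Gg g0; rewrite leNgt; apply/negP => ge.
    by apply: nG; exists g; rewrite ?g0.
  pose P := [set g | G g /\ 0 < g].
  have infP : has_inf P by split; [exists 1|exists 0 => g [_ /ltW]].
  have [g1 [Gg1 g10] g1e] := inf_adherent e0 infP.
  have g1min g : G g -> 0 < g -> g1 <= g.
    move=> Gg g0; rewrite leNgt; apply/negP => gg1.
    have := nG _ (GB _ _ Gg1 Gg); rewrite subr_gt0 => /(_ gg1).
    have : inf P <= g by apply: ge_inf => //; case: infP.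
    lra.
  have Gmul g : G g -> exists k : int, g = k%:~R * g1.
    move=> Gg; exists (Num.floor (g / g1)).
    have /andP[f1 f2] := floor_itv (g / g1).
    rewrite ler_pdivlMr// in f1; rewrite ltr_pdivrMr// intrD mulrDl mul1r in f2.
    have := g1min _ (GB _ _ Gg (GM _ (Num.floor (g / g1)) Gg1)).
    rewrite subr_gt0; move: f1; rewrite le_eqVlt => /orP[/eqP //|f1 /(_ f1)].
    lra.
  have [k xk] : exists k : int, x = k%:~R * g1.
    by apply: Gmul; exists 1, 0; rewrite mul1r addr0.
  have [l l1] := Gmul _ G1.
  apply: xirr; exists (k%:Q / l%:Q) => //.
  have l0 : l%:~R != 0 :> R.
    by apply: contra_eq_neq l1 => ->; rewrite mul0r oner_neq0.
  rewrite fmorph_div /= !ratr_int xk.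
  have -> : g1 = l%:~R^-1 by apply: (mulfI l0); rewrite -l1 divff.
  by [].
move=> y e e0; have [g Gg /andP[g0 ge]] := small e e0.
have [n [m E]] := GM _ (Num.floor (y / g)) Gg.
exists n, m; rewrite -E.
have /andP[f1 f2] := floor_itv (y / g).
rewrite ler_pdivlMr// in f1; rewrite ltr_pdivrMr// intrD mulrDl mul1r in f2.
rewrite ltr_norml; apply/andP; split; lra.
Qed.

Lemma cos_sin_periodz (x : R) (m : int) :
  cos (x + m%:~R * (pi *+ 2)) = cos x /\ sin (x + m%:~R * (pi *+ 2)) = sin x.
Proof.
have nat_case (n : nat) (y : R) :
    cos (y + n%:R * (pi *+ 2)) = cos y /\ sin (y + n%:R * (pi *+ 2)) = sin y.
  by rewrite mulr_natl (periodicn (@cosD2pi R)) (periodicn (@sinD2pi R)).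
case: m => n; first exact: nat_case.
have [E1 E2] := nat_case n.+1 (x + (Negz n)%:~R * (pi *+ 2)).
rewrite -E1 -E2 NegzE mulrNz -pmulrn.
by rewrite mulNr subrK.
Qed.

Lemma rotation_transitive (x y u v : R) : x * x + y * y = u * u + v * v ->
  exists t, u = cos t * x - sin t * y /\ v = cos t * y + sin t * x.
Proof.
set k := x * x + y * y => kE.
have [k0|k0] := eqVneq k 0.
  have sq0 (a b : R) : a * a + b * b = 0 -> a = 0 /\ b = 0.
    move=> /eqP; rewrite -!expr2 paddr_eq0 ?sqr_ge0// !sqrf_eq0.
    by move=> /andP[/eqP -> /eqP ->].
  have [-> ->] := sq0 _ _ k0; have [-> ->] := sq0 u v ltac:(by rewrite -kE).
  by exists 0; rewrite !mulr0 subr0 addr0.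
pose c := (u * x + v * y) / k; pose s := (v * x - u * y) / k.
have cs : c ^+ 2 + s ^+ 2 = 1.
  rewrite /c /s !expr_div_n -mulrDl.
  apply: (mulIf (expf_neq0 2 k0)); rewrite divfK ?expf_neq0// mul1r.
  rewrite [RHS]expr2 {2}kE /k; ring.
have [t [ct st]] : exists t, cos t = c /\ sin t = s.
  have s0 := sqr_ge0 s; have c0 := sqr_ge0 c.
  have c1 : -1 <= c <= 1.
    by rewrite -ler_norml -(ler_pXn2r (n := 2)) ?nnegrE// expr1n real_normK ?num_real//; lra.
  have Ec : cos (acos c) = c by apply: acosK; rewrite in_itv.
  have Es : sin (acos c) = `|s|.
    by rewrite sin_acos// -sqrtr_sqr; congr Num.sqrt; lra.
  have [sp|sn] := leP 0 s.
    by exists (acos c); rewrite Ec Es ger0_norm.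
  by exists (- acos c); rewrite cosN sinN Ec Es ltr0_norm// opprK.
exists t; rewrite ct st /c /s; split; apply: (mulIf k0).
  transitivity ((u * x + v * y) * x - (v * x - u * y) * y).
    by rewrite /k; ring.
  by field.
transitivity ((u * x + v * y) * y + (v * x - u * y) * x).
  by rewrite /k; ring.
by field.
Qed.

End Kronecker.

(** * Dense geodesics on tori *)

Section Torus.
Context {R : realType}.
Implicit Types (p q r y v a : 'rV[R]_4).

(** [e^(it) z + e^(iu) w j] for [r = z + w j]. *)
Definition torus_point r (t u : R) : 'rV[R]_4 :=
  quat (cos t * qre r - sin t * qi r) (cos t * qi r + sin t * qre r)
       (cos u * qj r - sin u * qk r) (cos u * qk r + sin u * qj r).

Lemma torus_pointP p q :
  qre p * qre p + qi p * qi p = qre q * qre q + qi q * qi q ->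
  qj p * qj p + qk p * qk p = qj q * qj q + qk q * qk q ->
  exists t u, q = torus_point p t u.
Proof.
move=> /rotation_transitive[t [E1 E2]] /rotation_transitive[u [E3 E4]].
by exists t, u; apply: quat_ext; rewrite !qE.
Qed.

(** Isolates the dependence on the first angle. *)
Lemma torus_point_trig r (u : R) : exists a b c : 'rV[R]_4,
  forall t, torus_point r t u = cos t *: a + sin t *: b + c.
Proof.
exists (quat (qre r) (qi r) 0 0), (quat (- qi r) (qre r) 0 0).
exists (quat 0 0 (cos u * qj r - sin u * qk r) (cos u * qk r + sin u * qj r)).
by move=> t; rewrite /torus_point; qring.
Qed.

Lemma continuous_trig (a b c : 'rV[R]_4) :
  continuous (fun t : R => cos t *: a + sin t *: b + c).
Proof.
move=> t; apply: cvgD; last exact: cvg_cst.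
apply: cvgD; apply: cvgZr_tmp; [exact: continuous_cos|exact: continuous_sin].
Qed.

Variables (H tau : R).

Lemma geodesic_qmulr p y s a :
  qmul (geodesic H tau p y s) a = geodesic H tau (qmul p a) (qmul y a) s.
Proof.
rewrite /geodesic scalerDr scalerDr !VD !VZ.
have B x z : qmul (x - z) a = qmul x a - qmul z a by qring.
by rewrite !(B, qmulDl, qmulZl, VZ, VD, V_qmul).
Qed.

(** When [y = r i], the geodesic is [e^(-iHs) r e^(i tau s)], and [j]
    anticommutes with [i]. *)
Lemma geodesic_torus r s :
  geodesic H tau r (qmul r quatI) s =
    torus_point r ((tau - H) * s) (- ((tau + H) * s)) /\
  geodesic H tau (qmul r quatI) (- r) s =
    qmul (torus_point r ((tau - H) * s) (- ((tau + H) * s))) quatI.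
Proof.
rewrite /torus_point mulrBl mulrDl cosN sinN !(cosD, sinD) cosN sinN /geodesic.
move: (cos (tau * s)) (sin (tau * s)) (cos (H * s)) (sin (H * s)) => c d e f.
by split; qring.
Qed.

Hypotheses (tau0 : 0 < tau) (Htau : `|H| < tau) (Hirr : irrational (H / tau)).

Lemma irrational_slope : irrational ((tau - H) / (tau + H)).
Proof.
have t0 : tau + H != 0.
  by rewrite gt_eqF//; move: Htau; rewrite ltr_norml => /andP[? _]; lra.
move=> [q _ qE]; apply: Hirr.
have q1 : 1 + ratr q != 0 :> R.
  rewrite qE (_ : 1 + _ = 2 * tau / (tau + H)); last by field.
  by rewrite !mulf_neq0 ?invr_eq0// gt_eqF.
exists ((1 - q) / (1 + q)) => //.
rewrite fmorph_div rmorphB rmorphD /= !rmorph1 qE; field.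
have -> : tau + H + (tau - H) = 2 * tau by ring.
by rewrite t0 mulf_neq0 // gt_eqF.
Qed.

(** The times are chosen so that the second angle is exactly [u] modulo [2 pi];
    at these times the first angle runs through a translate of the multiples of
    [(tau - H) / (tau + H)], which are dense modulo 1.  Both components of [K]
    are translated by [a] because the axis of the geodesics is only
    conjugate to [i]. *)
Lemma dense_torus (K : set ('rV[R]_4 * 'rV[R]_4)) r a : closed K ->
  (forall s, K (qmul (geodesic H tau r (qmul r quatI) s) a,
                qmul (geodesic H tau (qmul r quatI) (- r) s) a)) ->
  forall t u, K (qmul (torus_point r t u) a,
                 qmul (qmul (torus_point r t u) quatI) a).
Proof.
move=> cK Korb t u.
have AH : 0 < tau + H.
  by move: Htau; rewrite ltr_norml => /andP[? _]; lra.
pose L (w : R) := (qmul (torus_point r w u) a,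
                   qmul (qmul (torus_point r w u) quatI) a).
have cL : continuous L.
  have [x [y [z E]]] := torus_point_trig r u.
  have -> : L = fun w => (cos w *: qmul x a + sin w *: qmul y a + qmul z a,
    cos w *: qmul (qmul x quatI) a + sin w *: qmul (qmul y quatI) a +
    qmul (qmul z quatI) a).
    by apply/funext => w; rewrite /L E !(qmulDl, qmulZl).
  by move=> w; exact: (cvg_pair (@continuous_trig _ _ _ w) (@continuous_trig _ _ _ w)).
have cC : closed (L @^-1` K) by move/continuous_closedP : cL; apply.
have -> : K (qmul (torus_point r t u) a,
  qmul (qmul (torus_point r t u) quatI) a) = (L @^-1` K) t by [].
have /closure_id -> := cC.
move=> B /nbhs_ballP[e /= e0 eB].
have pi20 : 0 < (pi *+ 2 : R) := mulrn_wgt0 2 (pi_gt0 R).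
pose x := (tau - H) / (tau + H).
have [n [m nm]] := irrational_dense irrational_slope
  ((t + x * u) / (pi *+ 2)) (divr_gt0 e0 pi20).
pose s := (n%:~R * (pi *+ 2) - u) / (tau + H).
exists ((tau - H) * s + m%:~R * (pi *+ 2)); split; last first.
  apply: eB; rewrite /ball /= distrC.
  have -> : (tau - H) * s + m%:~R * (pi *+ 2) - t =
      (n%:~R * x + m%:~R - (t + x * u) / (pi *+ 2)) * (pi *+ 2).
    rewrite /s /x; move: (pi *+ 2) pi20 => P P0; field.
    by rewrite (gt_eqF AH) (gt_eqF P0).
  rewrite normrM (gtr0_norm pi20).
  by rewrite -ltr_pdivlMr; [exact: nm|exact: pi20].
have := Korb s; rewrite (geodesic_torus r s).1 (geodesic_torus r s).2.
have -> : torus_point r ((tau - H) * s) (- ((tau + H) * s)) =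
    torus_point r ((tau - H) * s + m%:~R * (pi *+ 2)) u.
  have -> : - ((tau + H) * s) = u + (- n)%:~R * (pi *+ 2).
    by rewrite /s mulrC divfK ?gt_eqF// mulrNz; ring.
  rewrite /torus_point !(cos_sin_periodz _ _).1 !(cos_sin_periodz _ _).2.
  by [].
by [].
Qed.

End Torus.

(** * Hopf fibration, circles on the 2-sphere, right translations *)

Section Hopf.
Context {R : realType}.
Implicit Types (p q r x y v a : 'rV[R]_4).

(** A solution of [x a = a i] is [a = x + i], except when [x = - i], where [j]
    is one. *)
Lemma hopf_lift x : qre x = 0 -> dot x x = 1 ->
  exists2 a, dot a a = 1 & qmul x a = qmul a quatI.
Proof.
move=> x0 xx; have [xI|xI] := eqVneq (x + quatI) 0.
  have -> : x = - quatI by apply/eqP; rewrite -addr_eq0 xI.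
  by exists (quat 0 0 1 0); [dring|qring].
pose b := x + quatI.
have bb : 0 < dot b b.
  by rewrite lt_neqAle dot_ge0 andbT eq_sym; apply: contra_neq xI => /dot_eq0.
have s0 : 0 < Num.sqrt (dot b b) by rewrite sqrtr_gt0.
exists ((Num.sqrt (dot b b))^-1 *: b).
  rewrite dotZl dotZr mulrA -invfM -expr2 sqr_sqrtr ?ltW// mulVf//.
  by rewrite gt_eqF.
rewrite qmulZr qmulZl; congr (_ *: _).
have xxE : qmul x x = - dot x x *: quat 1 0 0 0.
  by rewrite dot4E; apply: quat_ext; rewrite /qmul !qE x0; ring.
rewrite /b qmulDr qmulDl xxE xx; qring.
Qed.

(** Spherical circles of the same radius [arccos c] about [x0] and [x1]: a
    common point is [A (x0 + x1) + B n] with [n] the cross product of [x0] and [x1];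
    the first hypothesis on the inner product leaves room for [B]. *)
Lemma circles_meet x0 x1 (c : R) : qre x0 = 0 -> qre x1 = 0 ->
  dot x0 x0 = 1 -> dot x1 x1 = 1 ->
  2 * c ^+ 2 - 1 < dot x0 x1 -> dot x0 x1 < 1 ->
  exists x, [/\ qre x = 0, dot x x = 1, dot x x0 = c & dot x x1 = c].
Proof.
move=> r0 r1 x00 x11; set t := dot x0 x1 => ct t1.
pose n := quat 0 (qj x0 * qk x1 - qk x0 * qj x1)
  (qk x0 * qi x1 - qi x0 * qk x1) (qi x0 * qj x1 - qj x0 * qi x1).
have n0 : dot n x0 = 0 by rewrite /n !dot4E !qE; ring.
have n1 : dot n x1 = 0 by rewrite /n !dot4E !qE; ring.
have nn : dot n n = 1 - t ^+ 2.
  by rewrite -[1](mulr1 1) -{1}x00 -x11 /t /n !dot4E !qE r0 r1; ring.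
have nr : qre n = 0 by rewrite /n !qE.
have c2 := sqr_ge0 c.
have tp : 0 < 1 + t by lra.
have tm : 0 < 1 - t by lra.
pose A := c / (1 + t).
pose B := Num.sqrt ((1 - 2 * c ^+ 2 / (1 + t)) / (1 - t ^+ 2)).
have B2 : B ^+ 2 * (1 - t ^+ 2) = 1 - 2 * c ^+ 2 / (1 + t).
  have t2 : 0 < 1 - t ^+ 2.
    by rewrite (_ : _ - _ = (1 + t) * (1 - t)) ?mulr_gt0//; ring.
  rewrite sqr_sqrtr; first by rewrite divfK// gt_eqF.
  apply: divr_ge0; last exact: ltW.
  by rewrite subr_ge0 ler_pdivrMr//; lra.
clearbody n B.
exists (A *: (x0 + x1) + B *: n); split.
- by rewrite !qE r0 r1 nr; ring.
- rewrite !(dotDl, dotDr, dotZl, dotZr) (dotC x0 n) (dotC x1 n) n0 n1 x00 x11 nn.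
  rewrite (dotC x1 x0) -/t.
  transitivity (2 * A ^+ 2 * (1 + t) + B ^+ 2 * (1 - t ^+ 2)); first by ring.
  by rewrite B2 /A; field; rewrite gt_eqF.
- by rewrite !(dotDl, dotZl) n0 x00 (dotC x1) -/t /A; field; rewrite gt_eqF.
- by rewrite !(dotDl, dotZl) n1 x11 -/t /A; field; rewrite gt_eqF.
Qed.

Definition qmulr a x := qmul x a.

Lemma qmulr_is_linear a : linear (qmulr a).
Proof. by move=> k p q; rewrite /qmulr qmulDl qmulZl. Qed.

HB.instance Definition _ a :=
  GRing.isLinear.Build _ _ _ _ (qmulr a) (qmulr_is_linear a).

Lemma Ck_on_cst m n k (U : set 'rV[R]_m) (w : 'rV[R]_n) :
  Ck_on k U (fun=> w).
Proof.
elim: k w => [|k IH] w /=; first by move=> x _; exact: cst_continuous.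
split=> [x _|v]; first exact: differentiable_cst.
have -> : (fun x : 'rV[R]_m => 'd (fun=> w) x v) = fun=> 0.
  by apply/funext => x; rewrite (diff_cst w x).
exact: IH.
Qed.

Lemma diff_linear_rV m n (f : {linear 'rV[R]_m -> 'rV[R]_n}) (x : 'rV[R]_m) :
  'd f x = f :> ('rV[R]_m -> 'rV[R]_n).
Proof. by apply: diff_lin; exact: linear_rV_continuous. Qed.

Lemma smooth_linear m n (U : set 'rV[R]_m)
    (f : {linear 'rV[R]_m -> 'rV[R]_n}) :
  smooth_on U f.
Proof.
case=> [|k] /=; first by move=> x _; exact: linear_rV_continuous.
split=> [x _|v].
  by apply: linear_differentiable; exact: linear_rV_continuous.
have -> : (fun x : 'rV[R]_m => 'd f x v) = fun=> f v.
  by apply/funext => x; rewrite diff_linear_rV.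
exact: Ck_on_cst.
Qed.

Lemma congruent_qmulr a (S : set 'rV[R]_4) : dot a a = 1 ->
  congruent S (qmulr a @` S).
Proof.
move=> aa; exists (qmulr a); split=> //.
- have sm b : dot b b = 1 -> smooth_selfmap_S3 (qmulr b).
    move=> bb; split=> [p pp|].
      by rewrite /S3 /= /qmulr dot_qmulr bb mulr1; exact: pp.
    by exists setT; split; [exact: openT|by []|exact: smooth_linear].
  split; first exact: sm.
    exists (qmulr (qconj a)); split=> [|p _|p _]; first by apply: sm; rewrite dot_qconj.
    - by rewrite /qmulr qmul_conjK aa scale1r.
    - by rewrite /qmulr qmul_conjVK aa scale1r.
  by move=> p v w _ _ _; rewrite diff_linear_rV /qmulr dot_qmulr aa mulr1.
- have E1M p : E1 (qmul p a) = qmul (E1 p) a by rewrite /E1 qmulA.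
  have E2M p : E2 (qmul p a) = qmul (E2 p) a by rewrite /E2 qmulA.
  move=> p _; rewrite diff_linear_rV /qmulr; apply/seteqP; split=> v.
    move=> [_ [s [t ->]] <-]; exists s, t.
    by rewrite /= /qmulr E1M E2M qmulDl !qmulZl.
  move=> [s [t ->]]; exists (s *: E1 p + t *: E2 p); first by exists s, t.
  by rewrite /= /qmulr E1M E2M qmulDl !qmulZl.
Qed.

End Hopf.

(** * Surfaces foliated by Clifford tori *)

Section Rigidity.
Context {R : realType} (S : set 'rV[R]_4) (N : 'rV[R]_4 -> 'rV[R]_4) (H : R).
Hypotheses (SS3 : S `<=` S3) (hN : unit_normal S N)
  (Sch : forall p, S p -> exists U f, chart S U f /\ (f @` U) p)
  (Sns : forall p, ~ singular_point S p)
  (hH : has_constant_mean_curvature S N H).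
Hypotheses (cS : compact S) (kS : connected S)
  (Hirr : irrational (H / Num.sqrt (1 + H ^+ 2))).
Local Notation nu := (nu_h N).
Local Notation tau := (Num.sqrt (1 + H ^+ 2)).
Local Notation c := (H / tau).
Implicit Types (p q r x y v a e : 'rV[R]_4).

(** With [y = drift q], the vector [tau y - H i q = i (nu q)] is the
    characteristic direction: [drift q] is the second initial value of the
    geodesic through [q]. *)
Definition drift q := tau^-1 *: V (nu q + H *: q).
(** The geodesic through [q] is [e^(-iHs) q e^(tau s v)] with [v = axis q]. *)
Definition axis q := qmul (qconj q) (drift q).

Lemma tau_gt0 : 0 < tau.
Proof. by rewrite sqrtr_gt0; have := sqr_ge0 H; lra. Qed.

Lemma tau_sqr : tau * tau = 1 + H * H.
Proof. by rewrite -!expr2 sqr_sqrtr//; have := sqr_ge0 H; lra. Qed.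

Lemma norm_H_lt_tau : `|H| < tau.
Proof.
rewrite -(ltr_pXn2r (n := 2)) ?nnegrE ?(ltW tau_gt0)//.
by rewrite real_normK ?num_real// !expr2 tau_sqr; lra.
Qed.

(** The tori are neither empty nor degenerate to a circle. *)
Lemma tilt_sqr_lt1 : c ^+ 2 < 1.
Proof.
rewrite expr_div_n ltr_pdivrMr ?exprn_gt0 ?tau_gt0// mul1r.
by rewrite !expr2 tau_sqr; lra.
Qed.

Lemma nu_unit q : S q ->
  [/\ dot q q = 1, dot (nu q) (nu q) = 1, dot (nu q) q = 0 &
      dot (nu q) (V q) = 0].
Proof.
by move=> Sq; have [? ? ? _] := nu_h_spec SS3 hN Sch Sns Sq; split=> //; exact: (SS3 Sq).
Qed.

Lemma drift_spec q : S q ->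
  [/\ dot (drift q) (drift q) = 1, dot (V q) (drift q) = c,
      dot q (drift q) = 0 & qmul q (axis q) = drift q].
Proof.
move=> Sq; have [qq nn nq nV] := nu_unit Sq.
rewrite /axis qmulK qq scale1r /drift.
move: (nu q) nn nq nV => n nn nq nV.
have nqV : dot q (V n) = 0 by rewrite dotC V_skew nV oppr0.
have t0 := tau_gt0.
split=> //.
- rewrite dotZl dotZr dot_V !(dotDl, dotDr, dotZl, dotZr) nn nq (dotC q n) nq qq.
  transitivity (tau^-1 * tau^-1 * (tau * tau)); first by rewrite tau_sqr; ring.
  by move: (tau) t0 => t t0; field; rewrite gt_eqF.
- by rewrite dotZr dot_V dotDr dotZr (dotC q n) nq qq; ring.
- by rewrite dotZr VD VZ dotDr dotZr nqV (dotC q) dotV_id; ring.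
Qed.

Lemma axis_spec q : S q -> qre (axis q) = 0 /\ dot (axis q) (axis q) = 1.
Proof.
move=> Sq; have [dd _ qd qa] := drift_spec Sq.
have [qq _ _ _] := nu_unit Sq.
split; first by rewrite -qd /axis dot4E /qmul /qconj !qE; ring.
by rewrite /axis dot_qmull dot_qconj qq dd mul1r.
Qed.

Lemma drift_continuous : {within S, continuous drift}.
Proof.
apply/subspace_continuousP => p Sp.
have /subspace_continuousP /(_ _ Sp) cN := hN.1.
have cid : q @[q --> within S (nbhs p)] --> p by apply: cvg_within.
have cV : V q @[q --> within S (nbhs p)] --> V p.
  exact: (cvg_comp _ _ cid (@linear_rV_continuous _ _ _ (@V R) p)).
have ch : horizontal_part N q @[q --> within S (nbhs p)] --> horizontal_part N p.
  exact: (cvgB cN (cvgZ (cvg_dot cN cV) cV)).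
have e0 : enorm (horizontal_part N p) != 0.
  have h0 := horizontal_part_neq0 SS3 hN Sch Sns Sp.
  rewrite /enorm gt_eqF// sqrtr_gt0 lt_neqAle dot_ge0 andbT eq_sym.
  by apply: contra_neq h0 => /dot_eq0.
have ce : enorm (horizontal_part N q) @[q --> within S (nbhs p)] -->
    enorm (horizontal_part N p).
  exact: (cvg_comp _ _ (cvg_dot ch ch) (@sqrt_continuous R _)).
have cnu : nu q @[q --> within S (nbhs p)] --> nu p.
  exact: (cvgZ (cvgV e0 ce) ch).
have cs : nu q + H *: q @[q --> within S (nbhs p)] --> nu p + H *: p.
  exact: (cvgD cnu (cvgZ (cvg_cst H) cid)).
apply: cvgZ; first exact: cvg_cst.
exact: (cvg_comp _ _ cs (@linear_rV_continuous _ _ _ (@V R) _)).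
Qed.

Definition drift_graph := [set x | exists2 q, S q & x = (q, drift q)].

Lemma drift_graphP q y : drift_graph (q, y) <-> S q /\ y = drift q.
Proof. by split=> [[r Sr [-> ->]]//|[Sq ->]]; exists q. Qed.

Lemma drift_graph_compact : compact drift_graph.
Proof.
have -> : drift_graph = (fun q => (q, drift q)) @` S.
  by apply/seteqP; split=> x [q Sq] E; exists q.
apply: continuous_compact => //; apply/subspace_continuousP => p Sp.
have /subspace_continuousP /(_ _ Sp) cd := drift_continuous.
have cid : q @[q --> within S (nbhs p)] --> p by apply: cvg_within.
exact: (cvg_pair cid cd).
Qed.

Lemma drift_graph_path q y : drift_graph (q, y) -> exists c z : R -> 'rV[R]_4,
    [/\ c 0 = q, z 0 = y, \forall h \near (0 : R), drift_graph (c h, z h),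
      is_derive (0 : R) 1 c (tau *: y - H *: V q) &
      is_derive (0 : R) 1 z (- (tau *: q) - H *: V y)].
Proof.
move=> /drift_graphP[Sq ->].
have t0 : tau != 0 by rewrite gt_eqF ?tau_gt0.
have [k [k0 Sk dk dnu]] := characteristic_path SS3 hN Sch Sns hH Sq.
exists k, (drift \o k); split=> //=; first by rewrite k0.
- by apply: filterS Sk => h Sh; exists (k h).
- apply: (is_derive_eq dk).
  by rewrite /drift scalerA divff// scale1r VD VZ addrK.
- have dH : is_derive (0 : R) 1 (cst H : R -> R) 0 by exact: is_derive_cst.
  have dt : is_derive (0 : R) 1 (cst tau^-1 : R -> R) 0 by exact: is_derive_cst.
  have d1 := is_derive_scale dH dk.
  have d2 := is_derive_lin (@V R) (is_deriveD dnu d1).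
  have d3 := is_derive_scale dt d2.
  apply: (is_derive_eq d3); rewrite /= !scale0r !add0r /drift.
  have -> : tau *: q = tau^-1 *: ((1 + H * H) *: q).
    rewrite scalerA; congr (_ *: _).
    by apply: (mulfI t0); rewrite mulrA divff// mul1r tau_sqr.
    rewrite !(VD, VZ, VN, VV); move: (tau^-1) (nu q) => s n.
  by move: (V n) (V q) => P Q; qring.
Qed.

Lemma geodesic_in_surface q s : S q ->
  drift_graph (geodesic H tau q (drift q) s, geodesic H tau (drift q) (- q) s).
Proof.
move=> Sq; apply: (invariant_compact drift_graph_compact _ drift_graph_path).
  move=> p y /drift_graphP[Sp ->]; have [dd _ _ _] := drift_spec Sp.
  by split=> //; exact: (SS3 Sp).
by apply/drift_graphP.
Qed.

(** The whole torus [{e | <i e, e v> = c}], where [v] is the axis at [q],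
    lies in [S], and the axis is [v] at all its points.  Right translation by
    [a], with [v a = a i], turns it into a torus with constant [|z_1|] and
    [|z_2|], in which the geodesic through [q a] is dense. *)
Lemma torus_in_surface q e :
  S q -> dot e e = 1 -> dot (V e) (qmul e (axis q)) = c ->
  S e /\ drift e = qmul e (axis q).
Proof.
move=> Sq ee ce; have [ax0 ax1] := axis_spec Sq.
have [dd Vqd _ qax] := drift_spec Sq; have [qq _ _ _] := nu_unit Sq.
have [a aa xa] := hopf_lift ax0 ax1.
pose r := qmul q a.
have rI : qmul r quatI = qmul (drift q) a.
  by rewrite /r -qmulA -xa qmulA qax.
have back x : qmul (qmul x a) (qconj a) = x by rewrite qmul_conjK aa scale1r.
have hopfE p : dot (V p) (qmul p quatI) =
   qre p * qre p + qi p * qi p - (qj p * qj p + qk p * qk p) by dring.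
have cr : dot (V r) (qmul r quatI) = c.
  by rewrite rI /r V_qmul dot_qmulr aa mulr1.
have ce' : dot (V (qmul e a)) (qmul (qmul e a) quatI) = c.
  by rewrite -qmulA -xa qmulA V_qmul dot_qmulr aa mulr1.
have rr : dot r r = 1 by rewrite dot_qmulr qq aa mulr1.
have ea : dot (qmul e a) (qmul e a) = 1 by rewrite dot_qmulr ee aa mulr1.
rewrite hopfE in cr; rewrite hopfE in ce'; rewrite dot4E in rr; rewrite dot4E in ea.
have [t [u E]] : exists t u, qmul e a = torus_point r t u.
  by apply: torus_pointP; lra.
have closedK : closed drift_graph.
  by apply: compact_closed; [exact: norm_hausdorff|exact: drift_graph_compact].
have := @dense_torus R H tau tau_gt0 norm_H_lt_tau Hirr drift_graph r (qconj a) closedK.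
have eaI : qmul (qmul e a) quatI = qmul (qmul e (axis q)) a.
  by rewrite -qmulA -xa qmulA.
have orbit s : drift_graph (qmul (geodesic H tau r (qmul r quatI) s) (qconj a),
    qmul (geodesic H tau (qmul r quatI) (- r) s) (qconj a)).
  have rN : - r = qmul (- q) a by rewrite /r; qring.
  by rewrite rI rN -!geodesic_qmulr !back; exact: geodesic_in_surface.
move=> /(_ orbit t u); rewrite -E eaI !back => /drift_graphP[Se ->].
by [].
Qed.

(** Moving the factor [conj q] to the other side,
    [<axis q, v> = <drift q, q v>]. *)
Lemma dot_axis_continuous v : {within S, continuous (fun q => dot (axis q) v)}.
Proof.
have E q : dot (axis q) v = dot (drift q) (qmulr v q).
  by rewrite /axis /qmulr; move: (drift q) => d; dring.
under eq_fun do rewrite E.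
apply/subspace_continuousP => p Sp.
have /subspace_continuousP /(_ _ Sp) cd := drift_continuous.
have cid : q @[q --> within S (nbhs p)] --> p by apply: cvg_within.
exact: (cvg_dot cd (cvg_comp _ _ cid (@linear_rV_continuous _ _ _ (qmulr v) p))).
Qed.

(** Two tori with close axes meet, and the axis at a common point is determined
    by the surface. *)
Lemma axis_unique p q : S p -> S q -> 2 * c ^+ 2 - 1 < dot (axis p) (axis q) ->
  axis p = axis q.
Proof.
move=> Sp Sq cpq.
have [p0 p1] := axis_spec Sp; have [q0 q1] := axis_spec Sq.
have [pq1|pq1] := eqVneq (dot (axis p) (axis q)) 1.
  exact: dot_unit_eq.
have pq_lt1 : dot (axis p) (axis q) < 1.
  rewrite lt_neqAle pq1 /=.
  have := dot_ge0 (axis p - axis q).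
  rewrite !(dotDl, dotDr, dotNl, dotNr) p1 q1 (dotC (axis q)); lra.
have [x [x0 x1 xp xq]] := circles_meet p0 q0 p1 q1 cpq pq_lt1.
have [a aa xa] := hopf_lift x0 x1.
pose e := qconj a.
have ee : dot e e = 1 by rewrite dot_qconj.
have ex : V e = qmul e x.
  rewrite -[x]scale1r -aa -qmul_conjK xa -!qmulA qconjK aa scale1r.
  by [].
have ce y : dot (V e) (qmul e y) = dot x y by rewrite ex dot_qmull ee mul1r.
have [Se dp] := torus_in_surface Sp ee (etrans (ce _) xp).
have [_ dq] := torus_in_surface Sq ee (etrans (ce _) xq).
have := congr1 (qmul (qconj e)) (etrans (esym dp) dq).
by rewrite !qconjK ee !scale1r.
Qed.

(** By [axis_unique], the continuous function [<axis r, axis p>] takes no value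
    in the interval between [2 c^2 - 1] and [1], while its image is an interval
    which contains [1]. *)
Lemma axis_constant p q : S p -> S q -> axis p = axis q.
Proof.
move=> Sp Sq; have c1 := tilt_sqr_lt1.
have [p0 p1] := axis_spec Sp; have [q0 q1] := axis_spec Sq.
pose f r := dot (axis r) (axis p).
have : is_interval (f @` S).
  apply/connected_intervalP/connected_continuous_connected => //.
  exact: dot_axis_continuous.
move=> itv; apply: axis_unique => //; rewrite ltNge; apply/negP => cpq.
pose m := (1 + (2 * c ^+ 2 - 1)) / 2.
have [r Sr fr] : (f @` S) m.
  apply: (itv (f q) (f p)); [by exists q|by exists p|].
  rewrite {2}/f p1 /m; apply/andP; split; last lra.
  by rewrite /f dotC; lra.
have : axis p = axis r.
  by apply: axis_unique => //; rewrite dotC -/(f r) fr /m; lra.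
by move=> pr; move: fr; rewrite /f -pr p1 /m; lra.
Qed.

Lemma surface_torus p : S p ->
  S = [set q | dot q q = 1 /\ dot (V q) (qmul q (axis p)) = c].
Proof.
move=> Sp; apply/seteqP; split=> q.
  move=> Sq; have [_ cq _ qa] := drift_spec Sq.
  split; first exact: (SS3 Sq).
  by rewrite (axis_constant Sp Sq) qa.
by move=> [qq cq]; have [] := torus_in_surface Sp qq cq.
Qed.

(** After right translation by [a], the equation of [S] reads
    [|z_1|^2 - |z_2|^2 = c], hence [rho^2 = (1 + c) / 2]. *)
Lemma congruent_clifford : S !=set0 ->
  exists rho : R, [/\ 0 < rho, rho < 1 & congruent S (clifford_torus rho)].
Proof.
move=> [p Sp]; have [p0 p1] := axis_spec Sp.
have [a aa pa] := hopf_lift p0 p1.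
have /andP[c1 c2] : -1 < c < 1.
  rewrite -ltr_norml -(ltr_pXn2r (n := 2)) ?nnegrE// expr1n.
  by rewrite real_normK ?num_real//; exact: tilt_sqr_lt1.
have r0 : 0 < (1 + c) / 2 by lra.
have r2 : Num.sqrt ((1 + c) / 2) ^+ 2 = (1 + c) / 2 by rewrite sqr_sqrtr// ltW.
exists (Num.sqrt ((1 + c) / 2)); split; first by rewrite sqrtr_gt0.
  by rewrite -[ltRHS]sqrtr1 ltr_sqrt//; lra.
have -> : clifford_torus (Num.sqrt ((1 + c) / 2)) = qmulr a @` S.
  have hopfE q : dot (V q) (qmul q quatI) =
      2 * (qre q * qre q + qi q * qi q) - dot q q by dring.
  have key q : dot (V q) (qmul q (axis p)) =
      dot (V (qmul q a)) (qmul (qmul q a) quatI).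
    by rewrite -qmulA -pa qmulA V_qmul dot_qmulr aa mulr1.
  rewrite (surface_torus Sp); apply/seteqP; split=> r.
    move=> [rr]; rewrite r2 !expr2 => zr.
    have rE : r = qmul (qmul r (qconj a)) a.
      by rewrite qmul_conjVK aa scale1r.
    exists (qmul r (qconj a)); last exact: esym rE.
    split; first by rewrite dot_qmulr dot_qconj aa mulr1; exact: rr.
    rewrite key -rE hopfE zr [dot r r]rr; lra.
  move=> [q [qq cq] <-]; rewrite /qmulr.
  have qa1 : dot (qmul q a) (qmul q a) = 1 by rewrite dot_qmulr qq aa mulr1.
  split; first exact: qa1.
  by rewrite r2 !expr2; move: cq; rewrite key hopfE qa1; lra.
exact: congruent_qmulr.
Qed.

End Rigidity.

Theorem theorem5p10 (R : realType) (S : set 'rV[R]_4)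
    (N : 'rV[R]_4 -> 'rV[R]_4) (H : R) :
  embedded_surface S -> S !=set0 -> compact S -> connected S ->
  unit_normal S N ->
  (forall p, ~ singular_point S p) ->
  has_constant_mean_curvature S N H ->
  irrational (H / Num.sqrt (1 + H ^+ 2)) ->
  exists rho : R, [/\ 0 < rho, rho < 1 & congruent S (clifford_torus rho)].
Proof.
move=> [SS3 Sch] S0 cS kS hN Sns hH Hirr.
exact: (congruent_clifford SS3 hN Sch Sns hH cS kS Hirr S0).
Qed.
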